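(* (i) For $0\le\alpha<1$, the $\mathcal{S}^*_{car}$-radius of the class $\mathcal{BL}(\alpha)$ is $1/(1+\sqrt{1+\alpha})$. (ii) For $\beta>1$, the $\mathcal{S}^*_{car}$-radius of the class $\mathcal{M}(\beta)$ is $1/(4\beta-3)$.
   Context: $\mathbb{D}=\{z:|z|<1\}$; $\mathcal{A}$ is the class of analytic $f$ on $\mathbb{D}$ with $f(0)=0$, $f'(0)=1$. $F\prec G$ means $F=G\circ w$ for an analytic $w:\mathbb{D}\to\mathbb{D}$ with $w(0)=0$. $\mathcal{S}^*_{car}$ is the class of $f\in\mathcal{A}$ with $zf'(z)/f(z)\prec 1+z+z^2/2$. $\mathcal{BL}(\alpha)$ is the class of $f\in\mathcal{A}$ with $zf'(z)/f(z)\prec 1+z/(1-\alpha z^2)$; $\mathcal{M}(\beta)$ is the class of $f\in\mathcal{A}$ with $\operatorname{Re}(zf'(z)/f(z))<\beta$ on $\mathbb{D}$. For a class $\mathcal{F}\subseteq\mathcal{A}$, the $\mathcal{S}^*_{car}$-radius of $\mathcal{F}$ is the supremum of all $r\in(0,1]$ such that $f(rz)/r\in\mathcal{S}^*_{car}$ for every $f\in\mathcal{F}$. *)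

(* Defs.v *)
From Stdlib Require Import Reals ClassicalEpsilon.
From Coquelicot Require Import Coquelicot.

Open Scope C_scope.

Definition inD (z : C) : Prop := (Cmod z < 1)%R.

Definition Cis_derive (f : C -> C) (z l : C) : Prop :=
  is_derive (K := C_AbsRing) (V := C_NormedModule) f z l.

Definition analytic_D (f : C -> C) : Prop :=
  forall z, inD z -> ex_derive (K := C_AbsRing) (V := C_NormedModule) f z.

(* the complex derivative f'(z), chosen by description (unique when it exists) *)
Definition Cderiv (f : C -> C) (z : C) : C :=
  epsilon (inhabits (RtoC 0)) (fun l => Cis_derive f z l).

Definition classA (f : C -> C) : Prop :=
  analytic_D f /\ f (RtoC 0) = RtoC 0 /\ Cis_derive f (RtoC 0) (RtoC 1).

Definition subord (F G : C -> C) : Prop :=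
  exists w : C -> C, analytic_D w /\ (forall z, inD z -> inD (w z)) /\
    w (RtoC 0) = RtoC 0 /\ (forall z, inD z -> F z = G (w z)).

(* z f'(z) / f(z), extended at the removable point z = 0 by its limit 1
   (valid for f in A). *)
Definition zfpf (f : C -> C) (z : C) : C :=
  if Ceq_dec z (RtoC 0) then RtoC 1 else z * Cderiv f z / f z.

Definition phi_car (z : C) : C := RtoC 1 + z + z * z / RtoC 2.

Definition S_car (f : C -> C) : Prop := classA f /\ subord (zfpf f) phi_car.

Definition BL (alpha : R) (f : C -> C) : Prop :=
  classA f /\ subord (zfpf f) (fun z => RtoC 1 + z / (RtoC 1 - RtoC alpha * (z * z))).

(* M(beta): Re (z f'(z)/f(z)) < beta on D (the quotient being defined, i.e.
   f(z) <> 0 for z in D \ {0}) *)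
Definition M_class (beta : R) (f : C -> C) : Prop :=
  classA f /\ (forall z, inD z -> z <> RtoC 0 -> f z <> RtoC 0) /\
  (forall z, inD z -> (Re (zfpf f z) < beta)%R).

Definition Scar_radius_set (F : (C -> C) -> Prop) (r : R) : Prop :=
  (0 < r <= 1)%R /\
  forall f, F f -> S_car (fun z => f (RtoC r * z) / RtoC r).

Definition Scar_radius_is (F : (C -> C) -> Prop) (rho : R) : Prop :=
  is_lub (Scar_radius_set F) rho.

(* Main.v *)
Require Import Defs.
From Stdlib Require Import Reals Lra Psatz ClassicalEpsilon.
From Coquelicot Require Import Coquelicot.
Open Scope C_scope.

(* Since phi_car(w) = ((1 + w)^2 + 1) / 2, every F = 1 + s/2 with s analytic, s(0) = 0
   and |s| < 1 is subordinate to phi_car, through w = sqrt(1 + s) - 1, and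
   |w| <= |s| because |w + 2| >= 1.  For both classes the Schwarz lemma bounds s on the
   disc of the stated radius.  The radii are sharp because phi_car omits the real values
   at most 1/2, while z f'(z)/f(z) takes such values on the real axis just outside the
   radius for f = z exp(E), with E' = 1/(1 - alpha z^2), respectively
   E' = -2(beta - 1)/(1 - z).

   Functions are only assumed complex differentiable, so Cauchy's formula is derived by
   Goursat's argument.  Pulling f(Z) dZ/(Z - a) back by Z(s,t) = a + s (rad e^{it} - a)
   gives a form on a rectangle without singularity for s > 0; letting s tend to 0
   contracts the circle to a. *)

(** * Goursat's bisection *)

(** One disc settles both parts. On |w| = 1 one has |phi_car(w) - 1| = |1 + w/2| >= 1/2, with
    equality at w = -1, so |F - 1| < 1/2 is the largest disc about 1 inside the image of [phi_car].
    Each radius is the one at which z f'(z)/f(z) can first reach the boundary point 1/2 of that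
    disc. For [BL] the condition |u| / (1 - alpha |u|^2) < 1/2 leads to the quadratic alpha rho^2 +
    2 rho = 1. For [M_class] the map (F - 1)/(F - (2 beta - 1)) carries the half-plane Re F < beta
    to the unit disc, and solving for |F - 1| produces 4 beta - 3.

    The need for Cauchy's formula comes from two places. The Schwarz lemma has to control w(z)/z
    across the removable point 0. Moreover [M_class] only bounds a real part and hands over no
    analytic w, so the differentiability of z f'(z)/f(z), in effect a second derivative of f, has to
    be proved before the Schwarz lemma can be applied to it. *)

Lemma nested_intervals (u v : nat -> R) :
  (forall n, u n <= u (S n))%R -> (forall n, v (S n) <= v n)%R ->
  (forall n, u n <= v n)%R -> exists p, forall n, (u n <= p <= v n)%R.
Proof.
  intros Hu Hv Huv.
  assert (Hmu : forall n k, (u n <= u (k + n)%nat)%R).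
  { intros n k; induction k as [|k IH]; simpl; [lra|].
    specialize (Hu (k + n)%nat); lra. }
  assert (Hmv : forall n k, (v (k + n)%nat <= v n)%R).
  { intros n k; induction k as [|k IH]; simpl; [lra|].
    specialize (Hv (k + n)%nat); lra. }
  assert (Hcross : forall n m, (u n <= v m)%R).
  { intros n m. pose proof (Hmu n m). pose proof (Hmv m n).
    rewrite Nat.add_comm in H0. specialize (Huv (m + n)%nat). lra. }
  destruct (completeness (fun x => exists n, x = u n)) as [p [Hp1 Hp2]].
  - exists (v 0%nat). intros x [n ->]. apply Hcross.
  - exists (u 0%nat), 0%nat. reflexivity.
  - exists p. intros n. split.
    + apply Hp1. now exists n.
    + apply Hp2. intros x [m ->]. apply Hcross.
Qed.

(* Goursat's bisection: if the conclusion failed by a definite multiple of the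
   squared size, it would fail by the same multiple on some quarter, and so on
   down to a point contradicting the local estimate. *)
Lemma additive_rect_zero (B : R -> R -> R -> R -> C) (a b c d : R) :
  (a <= b)%R -> (c <= d)%R ->
  (forall s1 s2 s3 t1 t2, (a <= s1 <= s2)%R -> (s2 <= s3 <= b)%R ->
     (c <= t1 <= t2)%R -> (t2 <= d)%R ->
     B s1 s3 t1 t2 = B s1 s2 t1 t2 + B s2 s3 t1 t2) ->
  (forall s1 s2 t1 t2 t3, (a <= s1 <= s2)%R -> (s2 <= b)%R ->
     (c <= t1 <= t2)%R -> (t2 <= t3 <= d)%R ->
     B s1 s2 t1 t3 = B s1 s2 t1 t2 + B s1 s2 t2 t3) ->
  (forall s0 t0, (a <= s0 <= b)%R -> (c <= t0 <= d)%R ->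
     forall eps, (0 < eps)%R -> exists delta, (0 < delta)%R /\
     forall s1 s2 t1 t2, (a <= s1 <= s0)%R -> (s0 <= s2 <= b)%R ->
       (c <= t1 <= t0)%R -> (t0 <= t2 <= d)%R ->
       (s2 - s1 < delta)%R -> (t2 - t1 < delta)%R ->
       (Cmod (B s1 s2 t1 t2) <= eps * (s2 - s1 + (t2 - t1)) ^ 2)%R) ->
  B a b c d = 0.
Proof.
  intros Hab Hcd Hs Ht Hloc.
  assert (Hsmall : forall eps, (0 < eps)%R ->
    (Cmod (B a b c d) <= eps * (b - a + (d - c)) ^ 2)%R).
  { intros eps Heps.
    destruct (Rle_or_lt (Cmod (B a b c d)) (eps * (b - a + (d - c)) ^ 2)) as [H|Hbad0];
      [exact H|exfalso].
    set (good := fun q : (R * R) * (R * R) =>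
      let '((s1, s2), (t1, t2)) := q in
      (a <= s1 <= s2 /\ s2 <= b /\ c <= t1 <= t2 /\ t2 <= d /\
       eps * (s2 - s1 + (t2 - t1)) ^ 2 < Cmod (B s1 s2 t1 t2))%R).
    set (half := fun q q' : (R * R) * (R * R) =>
      let '((s1, s2), (t1, t2)) := q in
      let '((s1', s2'), (t1', t2')) := q' in
      (s1 <= s1' /\ s2' <= s2 /\ t1 <= t1' /\ t2' <= t2 /\
       s2' - s1' = (s2 - s1) / 2 /\ t2' - t1' = (t2 - t1) / 2)%R).
    assert (Hstep : forall q, good q -> exists q', good q' /\ half q q').
    { intros [[s1 s2] [t1 t2]] (H1 & H2 & H3 & H4 & H5).
      set (s := ((s1 + s2) / 2)%R). set (t := ((t1 + t2) / 2)%R).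
      assert (Hsm : (s1 <= s <= s2)%R) by (unfold s; lra).
      assert (Htm : (t1 <= t <= t2)%R) by (unfold t; lra).
      rewrite (Hs s1 s s2 t1 t2) in H5 by lra.
      rewrite (Ht s1 s t1 t t2), (Ht s s2 t1 t t2) in H5 by lra.
      (* Halving both sides divides the squared size by 4, so four quarters that all met the bound
         would give it for the whole rectangle by the triangle inequality. *)
      assert (Hsize : forall x y x' y', (x' - x = (s2 - s1) / 2)%R ->
        (y' - y = (t2 - t1) / 2)%R ->
        (eps * (x' - x + (y' - y)) ^ 2 = eps * (s2 - s1 + (t2 - t1)) ^ 2 / 4)%R).
      { intros x y x' y' -> ->. field. }
      pose proof (Hsize s1 t1 s t ltac:(unfold s; lra) ltac:(unfold t; lra)) as E1.
      pose proof (Hsize s1 t s t2 ltac:(unfold s; lra) ltac:(unfold t; lra)) as E2.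
      pose proof (Hsize s t1 s2 t ltac:(unfold s; lra) ltac:(unfold t; lra)) as E3.
      pose proof (Hsize s t s2 t2 ltac:(unfold s; lra) ltac:(unfold t; lra)) as E4.
      pose proof (Cmod_triangle (B s1 s t1 t + B s1 s t t2) (B s s2 t1 t + B s s2 t t2)) as T0.
      pose proof (Cmod_triangle (B s1 s t1 t) (B s1 s t t2)) as T1.
      pose proof (Cmod_triangle (B s s2 t1 t) (B s s2 t t2)) as T2.
      destruct (Rlt_or_le (eps * (s - s1 + (t - t1)) ^ 2) (Cmod (B s1 s t1 t))).
      { exists ((s1, s), (t1, t)). unfold good, half. repeat split; try lra; unfold s, t; lra. }
      destruct (Rlt_or_le (eps * (s - s1 + (t2 - t)) ^ 2) (Cmod (B s1 s t t2))).
      { exists ((s1, s), (t, t2)). unfold good, half. repeat split; try lra; unfold s, t; lra. }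
      destruct (Rlt_or_le (eps * (s2 - s + (t - t1)) ^ 2) (Cmod (B s s2 t1 t))).
      { exists ((s, s2), (t1, t)). unfold good, half. repeat split; try lra; unfold s, t; lra. }
      destruct (Rlt_or_le (eps * (s2 - s + (t2 - t)) ^ 2) (Cmod (B s s2 t t2))).
      { exists ((s, s2), (t, t2)). unfold good, half. repeat split; try lra; unfold s, t; lra. }
      exfalso; lra. }
    set (next := fun q => epsilon (inhabits q) (fun q' => good q' /\ half q q')).
    assert (Hnext : forall q, good q -> good (next q) /\ half q (next q)).
    { intros q Hq. unfold next. apply epsilon_spec. now apply Hstep. }
    set (sq := fix sq n := match n with O => ((a, b), (c, d)) | S n => next (sq n) end).
    assert (Hgood : forall n, good (sq n)).
    { induction n as [|n IH].
      - simpl. repeat split; lra.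
      - apply (Hnext _ IH). }
    assert (Hhalf : forall n, half (sq n) (sq (S n))).
    { intros n. apply (Hnext _ (Hgood n)). }
    assert (Hlen : forall n, (snd (fst (sq n)) - fst (fst (sq n)) = (b - a) * (/ 2) ^ n /\
                     snd (snd (sq n)) - fst (snd (sq n)) = (d - c) * (/ 2) ^ n)%R).
    { induction n as [|n IH].
      - simpl. lra.
      - specialize (Hhalf n). revert IH Hhalf.
        destruct (sq n) as [[x1 x2] [y1 y2]], (sq (S n)) as [[x1' x2'] [y1' y2']].
        simpl. intros [E1 E2] (_ & _ & _ & _ & E3 & E4). rewrite E3, E4, E1, E2. lra. }
    destruct (nested_intervals (fun n => fst (fst (sq n))) (fun n => snd (fst (sq n))))
      as [s0 Hs0];
      [intros n; specialize (Hhalf n); destruct (sq n) as [[x1 x2] [y1 y2]],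
        (sq (S n)) as [[x1' x2'] [y1' y2']]; simpl in *; lra..
      |intros n; specialize (Hgood n); destruct (sq n) as [[x1 x2] [y1 y2]]; simpl in *; lra|].
    destruct (nested_intervals (fun n => fst (snd (sq n))) (fun n => snd (snd (sq n))))
      as [t0 Ht0];
      [intros n; specialize (Hhalf n); destruct (sq n) as [[x1 x2] [y1 y2]],
        (sq (S n)) as [[x1' x2'] [y1' y2']]; simpl in *; lra..
      |intros n; specialize (Hgood n); destruct (sq n) as [[x1 x2] [y1 y2]]; simpl in *; lra|].
    destruct (Hloc s0 t0 (Hs0 0%nat) (Ht0 0%nat) eps Heps) as (delta & Hdelta & Hd).
    assert (Hpow : exists n, ((b - a + (d - c)) * (/ 2) ^ n < delta)%R).
    { destruct (pow_lt_1_zero (/ 2) ltac:(rewrite Rabs_pos_eq; lra)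
        (delta / (b - a + (d - c) + 1)) ltac:(apply Rdiv_lt_0_compat; lra)) as [n Hn].
      exists n. specialize (Hn n ltac:(lia)).
      rewrite Rabs_pos_eq in Hn by (apply pow_le; lra).
      apply (Rmult_lt_compat_l (b - a + (d - c) + 1)) in Hn; [|lra].
      replace ((b - a + (d - c) + 1) * (delta / (b - a + (d - c) + 1)))%R
        with delta in Hn by (field; lra).
      assert (0 < (/ 2) ^ n)%R by (apply pow_lt; lra). lra. }
    destruct Hpow as [n Hn].
    specialize (Hgood n). specialize (Hs0 n). specialize (Ht0 n). specialize (Hlen n).
    assert (0 < (/ 2) ^ n)%R by (apply pow_lt; lra).
    assert (0 <= (b - a) * (/ 2) ^ n)%R by (apply Rmult_le_pos; lra).
    assert (0 <= (d - c) * (/ 2) ^ n)%R by (apply Rmult_le_pos; lra).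
    destruct (sq n) as [[x1 x2] [y1 y2]]. simpl in *.
    specialize (Hd x1 x2 y1 y2). lra. }
  apply Cmod_eq_0.
  destruct (Rle_lt_or_eq_dec 0 _ (Cmod_ge_0 (B a b c d))) as [Hpos|]; [exfalso|easy].
  set (m := Cmod (B a b c d)) in *.
  set (S2 := ((b - a + (d - c)) ^ 2)%R) in *.
  assert (0 <= S2)%R by (unfold S2; apply pow2_ge_0).
  (* The [+ 1] keeps the quotient meaningful for a degenerate rectangle; the bound obtained is at
     most m / 2, which contradicts m > 0. *)
  assert (Hx := Hsmall (m / (2 * (S2 + 1)))%R ltac:(apply Rdiv_lt_0_compat; lra)).
  assert (m / (2 * (S2 + 1)) * S2 <= m / 2)%R; [|lra].
  replace (m / 2)%R with (m / (2 * (S2 + 1)) * (S2 + 1))%R by (field; lra).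
  apply Rmult_le_compat_l; [|lra]. apply Rlt_le, Rdiv_lt_0_compat; lra.
Qed.

Lemma Cminus_0_eq (u v : C) : u - v = 0 -> u = v.
Proof. intros H. replace u with (u - v + v) by ring. rewrite H. ring. Qed.

(** * Continuity and complex differentiation *)

(** The balls of [CU] are discs for the modulus, the neighbourhoods in which [is_derive] over
    [C_AbsRing] is phrased. *)
Definition CU : UniformSpace := AbsRing_UniformSpace C_AbsRing.

(** The target is measured by [Cmod] directly, so that one notion serves both paths ([T] the real
    line) and functions on the plane ([T := CU]). *)
Definition ccont {T : UniformSpace} (f : T -> C) (x : T) : Prop :=
  forall eps, (0 < eps)%R -> locally x (fun y => (Cmod (f y - f x) < eps)%R).

Lemma locally_CU (z : C) (P : C -> Prop) :
  locally (T := CU) z P <->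
  exists d, (0 < d)%R /\ forall y, (Cmod (y - z) < d)%R -> P y.
Proof.
  split.
  - intros [d Hd]. exists d. split; [apply cond_pos|]. intros y Hy. now apply Hd.
  - intros (d & Hd & H). exists (mkposreal d Hd). intros y Hy. now apply H.
Qed.

Lemma locally_R (x : R) (P : R -> Prop) :
  locally x P <-> exists d, (0 < d)%R /\ forall y, (Rabs (y - x) < d)%R -> P y.
Proof.
  split.
  - intros [d Hd]. exists d. split; [apply cond_pos|]. intros y Hy. now apply Hd.
  - intros (d & Hd & H). exists (mkposreal d Hd). intros y Hy. now apply H.
Qed.

Section Continuity.
Context {T : UniformSpace}.
Implicit Types (f g : T -> C) (x : T).

Lemma ccont_ext f g x : (forall y, f y = g y) -> ccont f x -> ccont g x.
Proof.
  intros E H eps Heps. apply filter_imp with (2 := H eps Heps).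
  intros y. now rewrite !E.
Qed.

Lemma ccont_const (c : C) x : ccont (fun _ => c) x.
Proof.
  intros eps Heps. apply filter_forall. intros y.
  replace (c - c) with (RtoC 0) by ring. now rewrite Cmod_0.
Qed.

Lemma ccont_plus f g x : ccont f x -> ccont g x -> ccont (fun y => f y + g y) x.
Proof.
  intros Hf Hg eps Heps. assert (He : (0 < eps / 2)%R) by lra.
  generalize (filter_and _ _ (Hf _ He) (Hg _ He)).
  apply filter_imp. intros y [H1 H2].
  replace (f y + g y - (f x + g x)) with ((f y - f x) + (g y - g x)) by ring.
  eapply Rle_lt_trans; [apply Cmod_triangle|lra].
Qed.

Lemma ccont_mult f g x : ccont f x -> ccont g x -> ccont (fun y => f y * g y) x.
Proof.
  intros Hf Hg eps Heps.
  set (M := (Cmod (f x) + Cmod (g x) + 1)%R).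
  pose proof (Cmod_ge_0 (f x)). pose proof (Cmod_ge_0 (g x)).
  set (e := Rmin 1 (eps / (2 * M))).
  assert (He : (0 < e)%R) by (apply Rmin_pos; [lra|apply Rdiv_lt_0_compat; unfold M; lra]).
  assert (HeM : (2 * e * M <= eps)%R).
  { apply Rle_trans with (2 * (eps / (2 * M)) * M)%R.
    - apply Rmult_le_compat_r; [unfold M; lra|].
      apply Rmult_le_compat_l; [lra|apply Rmin_r].
    - right. field. unfold M; lra. }
  generalize (filter_and _ _ (Hf e He) (Hg e He)).
  apply filter_imp. intros y [H1 H2].
  replace (f y * g y - f x * g x) with
    ((f y - f x) * (g y - g x) + (f y - f x) * g x + f x * (g y - g x)) by ring.
  eapply Rle_lt_trans; [apply Cmod_triangle|].
  eapply Rle_lt_trans; [apply Rplus_le_compat_r, Cmod_triangle|].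
  rewrite !Cmod_mult.
  pose proof (Cmod_ge_0 (f y - f x)). pose proof (Cmod_ge_0 (g y - g x)).
  assert (e <= 1)%R by apply Rmin_l.
  assert (Cmod (f y - f x) * Cmod (g y - g x) <= e * 1)%R
    by (apply Rmult_le_compat; lra).
  assert (Cmod (f y - f x) * Cmod (g x) <= e * Cmod (g x))%R
    by (apply Rmult_le_compat_r; lra).
  assert (Cmod (f x) * Cmod (g y - g x) <= Cmod (f x) * e)%R
    by (apply Rmult_le_compat_l; lra).
  apply Rle_lt_trans with (e * M)%R; unfold M in *; nra.
Qed.

Lemma ccont_opp f x : ccont f x -> ccont (fun y => - f y) x.
Proof.
  intros Hf. apply ccont_ext with (fun y => RtoC (-1) * f y).
  - intros y. ring.
  - apply ccont_mult; [apply ccont_const|exact Hf].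
Qed.

Lemma ccont_minus f g x : ccont f x -> ccont g x -> ccont (fun y => f y - g y) x.
Proof. intros Hf Hg. apply ccont_plus; [exact Hf|now apply ccont_opp]. Qed.

Lemma Cmod_triangle_inv (u v : C) : (Cmod u - Cmod v <= Cmod (u - v))%R.
Proof.
  pose proof (Cmod_triangle (u - v) v) as H.
  replace (u - v + v) with u in H by ring. lra.
Qed.

Lemma ccont_inv f x : f x <> 0 -> ccont f x -> ccont (fun y => / f y) x.
Proof.
  intros Hnz Hf eps Heps.
  set (m := Cmod (f x)). assert (Hm : (0 < m)%R) by now apply Cmod_gt_0.
  set (e := Rmin (m / 2) (eps * (m * m) / 2)).
  assert (He : (0 < e)%R) by (apply Rmin_pos; [lra|]; apply Rdiv_lt_0_compat; [|lra];
    repeat apply Rmult_lt_0_compat; lra).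
  generalize (Hf e He). apply filter_imp. intros y Hy.
  assert (e <= m / 2)%R by apply Rmin_l.
  assert (e <= eps * (m * m) / 2)%R by apply Rmin_r.
  assert (Hy2 : (m / 2 < Cmod (f y))%R).
  { pose proof (Cmod_triangle_inv (f x) (f y)).
    replace (f x - f y) with (- (f y - f x)) in H1 by ring.
    rewrite Cmod_opp in H1. fold m in H1. lra. }
  assert (Hny : f y <> 0) by (apply Cmod_gt_0; lra).
  replace (/ f y - / f x) with (- (f y - f x) * / (f y * f x)) by (field; auto).
  rewrite Cmod_mult, Cmod_opp, Cmod_inv, Cmod_mult by now apply Cmult_neq_0.
  fold m.
  assert (Hp : (m * m / 2 < Cmod (f y) * m)%R) by nra.
  apply Rmult_lt_reg_r with (Cmod (f y) * m)%R; [nra|].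
  rewrite Rmult_assoc, Rinv_l by nra. nra.
Qed.

Lemma ccont_div f g x :
  g x <> 0 -> ccont f x -> ccont g x -> ccont (fun y => f y / g y) x.
Proof. intros Hnz Hf Hg. apply ccont_mult; [exact Hf|now apply ccont_inv]. Qed.

Lemma ccont_pow f x n : ccont f x -> ccont (fun y => f y ^ n) x.
Proof.
  intros Hf. induction n as [|n IH]; simpl.
  - apply ccont_const.
  - now apply ccont_mult.
Qed.

Lemma ccont_comp (h : C -> C) f x :
  ccont f x -> ccont (T := CU) h (f x) -> ccont (fun y => h (f y)) x.
Proof.
  intros Hf Hh eps Heps.
  destruct (proj1 (locally_CU _ _) (Hh eps Heps)) as (d & Hd & H).
  generalize (Hf d Hd). apply filter_imp. intros y Hy. now apply H.
Qed.

Lemma ccont_neq_0 f x : ccont f x -> f x <> 0 -> locally x (fun y => f y <> 0).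
Proof.
  intros Hf Hnz. generalize (Hf _ (proj1 (Cmod_gt_0 _) Hnz)).
  apply filter_imp. intros y Hy E. rewrite E in Hy.
  replace (0 - f x) with (- f x) in Hy by ring. rewrite Cmod_opp in Hy. lra.
Qed.

Lemma ccont_Re_Im f x :
  ccont f x -> continuous (fun y => Re (f y)) x /\ continuous (fun y => Im (f y)) x.
Proof.
  intros Hf. split; apply filterlim_locally; intros eps;
    generalize (Hf eps (cond_pos eps)); apply filter_imp; intros y Hy;
    (eapply Rle_lt_trans; [|exact Hy]);
    (eapply Rle_trans; [|apply Rmax_Cmod]); [apply Rmax_l|apply Rmax_r].
Qed.

Lemma ccont_pair (u v : T -> R) x :
  continuous u x -> continuous v x -> ccont (fun y => (u y, v y) : C) x.
Proof.
  intros Hu Hv eps Heps.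
  assert (He : (0 < eps / 2)%R) by lra.
  generalize (filter_and _ _ (proj1 (filterlim_locally u (u x)) Hu (mkposreal _ He))
    (proj1 (filterlim_locally v (v x)) Hv (mkposreal _ He))).
  apply filter_imp. intros y [H1 H2].
  change (Rabs (u y - u x) < eps / 2)%R in H1.
  change (Rabs (v y - v x) < eps / 2)%R in H2.
  replace ((u y, v y) - (u x, v x)) with
    (RtoC (u y - u x) + Ci * RtoC (v y - v x))
    by (apply injective_projections; simpl; ring).
  eapply Rle_lt_trans; [apply Cmod_triangle|].
  rewrite Cmod_mult, Cmod_Ci, !Cmod_R. lra.
Qed.

Lemma ccont_RtoC (u : T -> R) x : continuous u x -> ccont (fun y => RtoC (u y)) x.
Proof. intros Hu. apply ccont_pair; [exact Hu|apply continuous_const]. Qed.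

End Continuity.

Lemma ccont_id (z : C) : ccont (T := CU) (fun y => y) z.
Proof. intros eps Heps. apply locally_CU. now exists eps. Qed.

Lemma Cis_derive_eps (f : C -> C) (z l : C) :
  Cis_derive f z l <->
  forall eps, (0 < eps)%R -> exists d, (0 < d)%R /\ forall y, (Cmod (y - z) < d)%R ->
    (Cmod (f y - f z - l * (y - z)) <= eps * Cmod (y - z))%R.
Proof.
  split.
  - intros [_ H] eps Heps.
    specialize (H z (fun P HP => HP) (mkposreal eps Heps)).
    apply (locally_CU z) in H. destruct H as (d & Hd & H).
    exists d. split; [exact Hd|]. intros y Hy. specialize (H y Hy).
    replace (f y - f z - l * (y - z)) with (f y - f z - (y - z) * l) by ring.
    exact H.
  - intros H. split.
    + apply (is_linear_scal_l (K := C_AbsRing) (V := C_NormedModule)).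
    + intros x Hx. apply (is_filter_lim_locally_unique (K := C_AbsRing)
        (V := AbsRing_NormedModule C_AbsRing)) in Hx. subst x.
      intros eps. destruct (H eps (cond_pos eps)) as (d & Hd & Hd').
      apply (locally_CU z). exists d. split; [exact Hd|].
      intros y Hy. specialize (Hd' y Hy).
      replace (f y - f z - l * (y - z)) with (f y - f z - (y - z) * l) in Hd' by ring.
      exact Hd'.
Qed.

(* Carath\'eodory's form of the derivative, which reduces the rules of calculus
   to the continuity of algebraic operations. *)
Lemma Cis_derive_slope (f : C -> C) (z l : C) :
  Cis_derive f z l <->
  exists p : C -> C, ccont (T := CU) p z /\ p z = l /\
    forall y, f y = f z + p y * (y - z).
Proof.
  rewrite Cis_derive_eps. split.
  - intros H.
    exists (fun y => if Ceq_dec y z then l else (f y - f z) / (y - z)).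
    split; [|split].
    + intros eps Heps. destruct (H (eps / 2)%R ltac:(lra)) as (d & Hd & H').
      apply locally_CU. exists d. split; [exact Hd|]. intros y Hy.
      destruct (Ceq_dec z z) as [_|n]; [|now elim n].
      destruct (Ceq_dec y z) as [_|n].
      { replace (l - l) with (RtoC 0) by ring. now rewrite Cmod_0. }
      assert (Hn : y - z <> 0) by (intros E; apply n; now apply Cminus_0_eq).
      specialize (H' y Hy).
      replace ((f y - f z) / (y - z) - l) with
        ((f y - f z - l * (y - z)) / (y - z)) by (field; auto).
      rewrite Cmod_div by auto. apply Cmod_gt_0 in Hn.
      apply Rle_lt_trans with (eps / 2)%R; [|lra].
      apply Rmult_le_reg_r with (Cmod (y - z)); [exact Hn|].
      unfold Rdiv at 1. rewrite Rmult_assoc, Rinv_l by lra. lra.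
    + now destruct (Ceq_dec z z).
    + intros y. destruct (Ceq_dec y z) as [->|n]; [ring|].
      field. intros E; apply n; now apply Cminus_0_eq.
  - intros (p & Hp & <- & E) eps Heps.
    destruct (proj1 (locally_CU _ _) (Hp eps Heps)) as (d & Hd & H).
    exists d. split; [exact Hd|]. intros y Hy.
    rewrite (E y).
    replace (f z + p y * (y - z) - f z - p z * (y - z)) with
      ((p y - p z) * (y - z)) by ring.
    rewrite Cmod_mult. apply Rmult_le_compat_r; [apply Cmod_ge_0|].
    apply Rlt_le, H, Hy.
Qed.

Lemma Cis_derive_ext_loc (f g : C -> C) (z l : C) :
  locally (T := CU) z (fun y => f y = g y) -> Cis_derive f z l -> Cis_derive g z l.
Proof.
  intros E. rewrite !Cis_derive_eps. intros H eps Heps.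
  pose proof (locally_singleton _ _ E) as E0. simpl in E0.
  apply locally_CU in E. destruct E as (d1 & Hd1 & E).
  destruct (H eps Heps) as (d2 & Hd2 & H').
  exists (Rmin d1 d2). split; [now apply Rmin_pos|]. intros y Hy.
  rewrite <- (E y), <- E0.
  - apply H'. eapply Rlt_le_trans; [exact Hy|apply Rmin_r].
  - eapply Rlt_le_trans; [exact Hy|apply Rmin_l].
Qed.

Lemma Cis_derive_ext (f g : C -> C) (z l : C) :
  (forall y, f y = g y) -> Cis_derive f z l -> Cis_derive g z l.
Proof. intros E. apply Cis_derive_ext_loc. now apply filter_forall. Qed.

Lemma Cis_derive_ccont (f : C -> C) (z l : C) :
  Cis_derive f z l -> ccont (T := CU) f z.
Proof.
  intros (p & Hp & _ & E)%Cis_derive_slope.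
  apply (ccont_ext (T := CU)) with (fun y => f z + p y * (y - z)).
  { intros y. now rewrite <- E. }
  apply (ccont_plus (T := CU)); [apply (ccont_const (T := CU))|]. apply (ccont_mult (T := CU)); [exact Hp|].
  apply (ccont_minus (T := CU)); [apply ccont_id|apply (ccont_const (T := CU))].
Qed.

Lemma Cis_derive_const (c z : C) : Cis_derive (fun _ => c) z 0.
Proof.
  apply Cis_derive_slope. exists (fun _ => RtoC 0).
  split; [apply (ccont_const (T := CU))|]. split; [easy|]. intros y. ring.
Qed.

Lemma Cis_derive_id (z : C) : Cis_derive (fun y => y) z 1.
Proof.
  apply Cis_derive_slope. exists (fun _ => RtoC 1).
  split; [apply (ccont_const (T := CU))|]. split; [easy|]. intros y. ring.
Qed.

Lemma Cis_derive_plus (f g : C -> C) (z l m : C) :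
  Cis_derive f z l -> Cis_derive g z m -> Cis_derive (fun y => f y + g y) z (l + m).
Proof.
  rewrite !Cis_derive_slope. intros (p & Hp & <- & Ef) (q & Hq & <- & Eg).
  exists (fun y => p y + q y). split; [now apply (ccont_plus (T := CU))|]. split; [easy|].
  intros y. rewrite (Ef y), (Eg y). ring.
Qed.

Lemma Cis_derive_mult (f g : C -> C) (z l m : C) :
  Cis_derive f z l -> Cis_derive g z m ->
  Cis_derive (fun y => f y * g y) z (l * g z + f z * m).
Proof.
  intros Hf Hg. pose proof (Cis_derive_ccont _ _ _ Hg) as Cg. revert Hf Hg.
  rewrite !Cis_derive_slope. intros (p & Hp & <- & Ef) (q & Hq & <- & Eg).
  exists (fun y => p y * g y + f z * q y).
  split.
  { apply (ccont_plus (T := CU)); apply (ccont_mult (T := CU)); try assumption.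
    apply (ccont_const (T := CU)). }
  split; [easy|].
  intros y. rewrite (Ef y).
  replace ((f z + p y * (y - z)) * g y) with (f z * g y + p y * (y - z) * g y) by ring.
  rewrite (Eg y) at 1. ring.
Qed.

Lemma Cis_derive_scal (c : C) (f : C -> C) (z l : C) :
  Cis_derive f z l -> Cis_derive (fun y => c * f y) z (c * l).
Proof.
  intros H. replace (c * l) with (0 * f z + c * l) by ring.
  apply Cis_derive_mult; [apply Cis_derive_const|exact H].
Qed.

Lemma Cis_derive_minus (f g : C -> C) (z l m : C) :
  Cis_derive f z l -> Cis_derive g z m -> Cis_derive (fun y => f y - g y) z (l - m).
Proof.
  intros Hf Hg. replace (l - m) with (l + (-1) * m) by ring.
  apply Cis_derive_ext with (fun y => f y + (-1) * g y); [intros y; ring|].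
  apply Cis_derive_plus; [exact Hf|now apply Cis_derive_scal].
Qed.

Lemma Cis_derive_inv (f : C -> C) (z l : C) :
  f z <> 0 -> Cis_derive f z l -> Cis_derive (fun y => / f y) z (- l / (f z * f z)).
Proof.
  intros Hnz Hf. pose proof (Cis_derive_ccont _ _ _ Hf) as Cf.
  apply Cis_derive_slope in Hf. destruct Hf as (p & Hp & <- & Ef).
  assert (HL := ccont_neq_0 (T := CU) f z Cf Hnz).
  apply Cis_derive_ext_loc with
    (fun y => / f z + (- p y / (f y * f z)) * (y - z)).
  { generalize HL. apply filter_imp. intros y Hy.
    transitivity (/ f z + - (f y - f z) / (f y * f z)).
    - rewrite (Ef y) at 2. field. auto.
    - field. auto. }
  apply Cis_derive_slope. exists (fun y => - p y / (f y * f z)).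
  split; [|split; [easy|]].
  - apply (ccont_div (T := CU)); [now apply Cmult_neq_0|now apply (ccont_opp (T := CU))|].
    apply (ccont_mult (T := CU)); [exact Cf|apply (ccont_const (T := CU))].
  - intros y. replace (z - z) with (RtoC 0) by ring. ring.
Qed.

Lemma Cis_derive_div (f g : C -> C) (z l m : C) :
  g z <> 0 -> Cis_derive f z l -> Cis_derive g z m ->
  Cis_derive (fun y => f y / g y) z ((l * g z - f z * m) / (g z * g z)).
Proof.
  intros Hnz Hf Hg.
  replace ((l * g z - f z * m) / (g z * g z)) with
    (l * / g z + f z * (- m / (g z * g z))) by (field; auto).
  apply (Cis_derive_mult f (fun y => / g y)); [exact Hf|now apply Cis_derive_inv].
Qed.

Lemma Cis_derive_comp (f g : C -> C) (z l m : C) :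
  Cis_derive f (g z) l -> Cis_derive g z m ->
  Cis_derive (fun y => f (g y)) z (l * m).
Proof.
  intros Hf Hg. pose proof (Cis_derive_ccont _ _ _ Hg) as Cg. revert Hf Hg.
  rewrite !Cis_derive_slope. intros (p & Hp & <- & Ef) (q & Hq & <- & Eg).
  exists (fun y => p (g y) * q y). split; [|split; [easy|]].
  - apply (ccont_mult (T := CU)); [|exact Hq]. apply (ccont_comp (T := CU) p g z); auto.
  - intros y. rewrite (Ef (g y)).
    replace (g y - g z) with (q y * (y - z)) by (rewrite (Eg y); ring). ring.
Qed.

(** The value picked by [epsilon] is itself a derivative once one exists, so both it and l equal
    [C_derive f z]. *)
Lemma Cderiv_unique (f : C -> C) (z l : C) : Cis_derive f z l -> Cderiv f z = l.
Proof.
  intros H. rewrite <- (is_C_derive_unique f z l H).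
  symmetry. apply is_C_derive_unique.
  unfold Cderiv. apply epsilon_spec. now exists l.
Qed.

(** * Integration of complex functions of a real variable *)

Definition CI (f : R -> C) (a b : R) : C := RInt (V := C_R_CompleteNormedModule) f a b.

Definition cont_on (f : R -> C) (a b : R) : Prop :=
  forall t, (a <= t <= b)%R -> ccont f t.

Lemma ccont_continuous (f : R -> C) (t : R) :
  ccont f t -> continuous (U := C_R_NormedModule) f t.
Proof.
  intros [H1 H2]%ccont_Re_Im P [eps HP]. change (locally t (fun y => P (f y))).
  generalize (filter_and _ _ (proj1 (filterlim_locally _ _) H1 eps)
    (proj1 (filterlim_locally _ _) H2 eps)).
  apply filter_imp. intros y Hy. apply HP. exact Hy.
Qed.

Lemma is_RInt_CI (f : R -> C) (a b : R) :
  (a <= b)%R -> cont_on f a b -> is_RInt (V := C_R_NormedModule) f a b (CI f a b).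
Proof.
  intros Hab Hf. apply (RInt_correct (V := C_R_CompleteNormedModule)).
  apply (ex_RInt_continuous (V := C_R_CompleteNormedModule)). intros t Ht.
  rewrite Rmin_left, Rmax_right in Ht by lra.
  apply ccont_continuous. now apply Hf.
Qed.

Lemma cont_on_bounded (f : R -> C) (a b : R) :
  cont_on f a b -> exists M, (0 < M)%R /\ forall t, (a <= t <= b)%R -> (Cmod (f t) <= M)%R.
Proof.
  intros Hf.
  destruct (bounded_continuity (V := C_R_NormedModule) f a b) as [M HM].
  { intros t Ht. now apply ccont_continuous, Hf. }
  exists (Rmax 1 M). split; [eapply Rlt_le_trans; [|apply Rmax_l]; lra|].
  intros t Ht. rewrite Cmod_norm. eapply Rle_trans; [|apply Rmax_r].
  now apply Rlt_le, HM.
Qed.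

Lemma is_RInt_CI_unique (f : R -> C) (a b : R) (l : C) :
  is_RInt (V := C_R_NormedModule) f a b l -> CI f a b = l.
Proof. intros H. now apply (is_RInt_unique (V := C_R_CompleteNormedModule)). Qed.

Lemma CI_ext (f g : R -> C) (a b : R) :
  (a <= b)%R -> (forall t, (a <= t <= b)%R -> f t = g t) -> CI f a b = CI g a b.
Proof.
  intros Hab H. apply (RInt_ext (V := C_R_CompleteNormedModule)).
  intros t Ht. rewrite Rmin_left, Rmax_right in Ht by lra. apply H. lra.
Qed.

Lemma CI_plus (f g : R -> C) (a b : R) :
  (a <= b)%R -> cont_on f a b -> cont_on g a b ->
  CI (fun t => f t + g t) a b = CI f a b + CI g a b.
Proof.
  intros Hab Hf Hg. apply is_RInt_CI_unique.
  apply (is_RInt_plus (V := C_R_NormedModule)); now apply is_RInt_CI.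
Qed.

(** The integral is linear over the reals only; a complex factor mixes the two components, which are
    therefore integrated separately. *)
Lemma CI_scal (c : C) (f : R -> C) (a b : R) :
  (a <= b)%R -> cont_on f a b -> CI (fun t => c * f t) a b = c * CI f a b.
Proof.
  intros Hab Hf. apply is_RInt_CI_unique.
  pose proof (is_RInt_CI f a b Hab Hf) as H.
  pose proof (is_RInt_fct_extend_fst (U := R_NormedModule) (V := R_NormedModule) _ _ _ _ H) as H1.
  pose proof (is_RInt_fct_extend_snd (U := R_NormedModule) (V := R_NormedModule) _ _ _ _ H) as H2.
  apply (is_RInt_fct_extend_pair (U := R_NormedModule) (V := R_NormedModule)); simpl.
  - apply (is_RInt_minus (V := R_NormedModule));
      now apply (is_RInt_scal (V := R_NormedModule)).
  - apply (is_RInt_plus (V := R_NormedModule));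
      now apply (is_RInt_scal (V := R_NormedModule)).
Qed.

Lemma CI_minus (f g : R -> C) (a b : R) :
  (a <= b)%R -> cont_on f a b -> cont_on g a b ->
  CI (fun t => f t - g t) a b = CI f a b - CI g a b.
Proof.
  intros Hab Hf Hg. apply is_RInt_CI_unique.
  apply (is_RInt_minus (V := C_R_NormedModule)); now apply is_RInt_CI.
Qed.

Lemma CI_conj (f : R -> C) (a b : R) :
  (a <= b)%R -> cont_on f a b -> CI (fun t => Cconj (f t)) a b = Cconj (CI f a b).
Proof.
  intros Hab Hf. apply is_RInt_CI_unique.
  pose proof (is_RInt_CI f a b Hab Hf) as H.
  pose proof (is_RInt_fct_extend_fst (U := R_NormedModule) (V := R_NormedModule) _ _ _ _ H) as H1.
  pose proof (is_RInt_fct_extend_snd (U := R_NormedModule) (V := R_NormedModule) _ _ _ _ H) as H2.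
  apply (is_RInt_fct_extend_pair (U := R_NormedModule) (V := R_NormedModule)); simpl.
  - exact H1.
  - now apply (is_RInt_opp (V := R_NormedModule)).
Qed.

Lemma CI_Chasles (f : R -> C) (a b c : R) :
  (a <= b)%R -> (b <= c)%R -> cont_on f a c -> CI f a c = CI f a b + CI f b c.
Proof.
  intros Hab Hbc Hf. apply is_RInt_CI_unique.
  apply (is_RInt_Chasles (V := C_R_NormedModule)) with b;
    apply is_RInt_CI; try assumption; intros t Ht; apply Hf; lra.
Qed.

Lemma CI_bound (f : R -> C) (a b M : R) :
  (a <= b)%R -> cont_on f a b -> (forall t, (a <= t <= b)%R -> (Cmod (f t) <= M)%R) ->
  (Cmod (CI f a b) <= (b - a) * M)%R.
Proof.
  intros Hab Hf HM. rewrite Cmod_norm.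
  apply (norm_RInt_le_const (V := C_R_NormedModule) f a b); [assumption| |now apply is_RInt_CI].
  intros t Ht. rewrite <- Cmod_norm. now apply HM.
Qed.

Lemma CI_derive (F f : R -> C) (a b : R) :
  (a <= b)%R -> cont_on f a b ->
  (forall t, (a <= t <= b)%R -> is_derive (fun t => Re (F t)) t (Re (f t))) ->
  (forall t, (a <= t <= b)%R -> is_derive (fun t => Im (F t)) t (Im (f t))) ->
  CI f a b = F b - F a.
Proof.
  intros Hab Hf H1 H2. apply is_RInt_CI_unique.
  apply (is_RInt_fct_extend_pair (U := R_NormedModule) (V := R_NormedModule)).
  - apply (is_RInt_derive (fun t => Re (F t)) (fun t => Re (f t)));
      rewrite Rmin_left, Rmax_right by lra; intros t Ht; [now apply H1|].
    now apply (ccont_Re_Im f t), Hf.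
  - apply (is_RInt_derive (fun t => Im (F t)) (fun t => Im (f t)));
      rewrite Rmin_left, Rmax_right by lra; intros t Ht; [now apply H2|].
    now apply (ccont_Re_Im f t), Hf.
Qed.

Lemma CI_const (c : C) (a b : R) : (a <= b)%R -> CI (fun _ => c) a b = RtoC (b - a) * c.
Proof.
  intros Hab.
  rewrite (CI_derive (fun t => RtoC t * c) (fun _ => c)); try assumption.
  - rewrite RtoC_minus. ring.
  - intros t _. apply ccont_const.
  - intros t _. simpl. auto_derive; [easy|unfold Re; ring].
  - intros t _. simpl. auto_derive; [easy|unfold Im; ring].
Qed.

Definition cis (t : R) : C := (cos t, sin t).

Lemma Cmod_cis (t : R) : Cmod (cis t) = 1%R.
Proof.
  unfold Cmod, cis. simpl. transitivity (sqrt 1); [f_equal|apply sqrt_1].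
  pose proof (sin2_cos2 t) as H. unfold Rsqr in H. lra.
Qed.

Lemma ccont_cis (t : R) : ccont cis t.
Proof.
  apply ccont_pair; apply (ex_derive_continuous (V := R_NormedModule)); now auto_derive.
Qed.

Lemma CI_cis (a b : R) : (a <= b)%R -> CI (fun t => Ci * cis t) a b = cis b - cis a.
Proof.
  intros Hab. apply CI_derive; [assumption| | |].
  - intros t _. apply ccont_mult; [apply ccont_const|apply ccont_cis].
  - intros t _. simpl. auto_derive; [easy|ring].
  - intros t _. simpl. auto_derive; [easy|ring].
Qed.

(** A chord is no longer than its arc: the chord is the integral of [Ci * cis], which has modulus
    1. *)
Lemma cis_Lipschitz (t u : R) : (Cmod (cis t - cis u) <= Rabs (t - u))%R.
Proof.
  assert (H : forall a b, (a <= b)%R -> (Cmod (cis b - cis a) <= b - a)%R).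
  { intros a b Hab. rewrite <- CI_cis by assumption.
    eapply Rle_trans; [apply (CI_bound _ _ _ 1); [assumption| |]|lra].
    - intros s _. apply ccont_mult; [apply ccont_const|apply ccont_cis].
    - intros s _. rewrite Cmod_mult, Cmod_Ci, Cmod_cis. lra. }
  destruct (Rle_or_lt u t) as [Hut|Hut].
  - rewrite Rabs_pos_eq by lra. now apply H.
  - rewrite Rabs_left by lra.
    replace (cis t - cis u) with (- (cis u - cis t)) by ring.
    rewrite Cmod_opp. specialize (H t u). lra.
Qed.

Lemma ccont_R (t : R) : ccont RtoC t.
Proof. apply ccont_RtoC, continuous_id. Qed.

(** * Cauchy's formula *)

Section CauchyForm.
Variables (rad : R) (a : C).
Hypothesis Ha : (Cmod a < rad)%R.

Let zeta (t : R) : C := RtoC rad * cis t.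
(** Since zeta' = i zeta and Z - a = s (zeta - a), the form dZ / (Z - a) pulls back to ds / s + i
    k(t) dt: its coefficients separate, and the only singularity is at s = 0. *)
Let k (t : R) : C := zeta t / (zeta t - a).
Let Z (s t : R) : C := a + RtoC s * (zeta t - a).

Let rad_pos : (0 < rad)%R.
Proof. pose proof (Cmod_ge_0 a). lra. Qed.

Let Cmod_zeta (t : R) : Cmod (zeta t) = rad.
Proof.
  unfold zeta. rewrite Cmod_mult, Cmod_cis, Cmod_R, Rabs_pos_eq by lra. ring.
Qed.

Let zeta_a (t : R) : (rad - Cmod a <= Cmod (zeta t - a))%R.
Proof. rewrite <- (Cmod_zeta t). apply Cmod_triangle_inv. Qed.

Let zeta_a_le (t : R) : (Cmod (zeta t - a) <= 2 * rad)%R.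
Proof.
  eapply Rle_trans; [apply Cmod_triangle|]. rewrite Cmod_opp, Cmod_zeta. lra.
Qed.

Let zeta_a_neq (t : R) : zeta t - a <> 0.
Proof. apply Cmod_gt_0. specialize (zeta_a t). lra. Qed.

Let cont_zeta (t : R) : ccont zeta t.
Proof. apply ccont_mult; [apply ccont_const|apply ccont_cis]. Qed.

Let cont_zeta_a (t : R) : ccont (fun t => zeta t - a) t.
Proof. apply ccont_minus; [apply cont_zeta|apply ccont_const]. Qed.

Let cont_k (t : R) : ccont k t.
Proof. apply ccont_div; [apply zeta_a_neq|apply cont_zeta|apply cont_zeta_a]. Qed.

Let k_bound (t : R) : (Cmod (k t) <= rad / (rad - Cmod a))%R.
Proof.
  unfold k. rewrite Cmod_div, Cmod_zeta by apply zeta_a_neq.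
  apply Rmult_le_compat_l; [lra|]. apply Rinv_le_contravar; [lra|apply zeta_a].
Qed.

Let Z_in (s t : R) : (0 <= s <= 1)%R -> (Cmod (Z s t) <= rad)%R.
Proof.
  intros Hs. unfold Z.
  replace (a + RtoC s * (zeta t - a)) with (RtoC (1 - s) * a + RtoC s * zeta t)
    by (rewrite RtoC_minus; ring).
  eapply Rle_trans; [apply Cmod_triangle|].
  rewrite !Cmod_mult, Cmod_zeta, !Cmod_R, !Rabs_pos_eq by lra. nra.
Qed.

Let Z_Lipschitz (s t s0 t0 : R) : (0 <= s0 <= 1)%R ->
  (Cmod (Z s t - Z s0 t0) <= 2 * rad * (Rabs (s - s0) + Rabs (t - t0)))%R.
Proof.
  intros Hs0. unfold Z.
  replace (a + RtoC s * (zeta t - a) - (a + RtoC s0 * (zeta t0 - a))) with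
    (RtoC (s - s0) * (zeta t - a) + RtoC s0 * RtoC rad * (cis t - cis t0))
    by (unfold zeta; rewrite RtoC_minus; ring).
  eapply Rle_trans; [apply Cmod_triangle|].
  rewrite !Cmod_mult, !Cmod_R, (Rabs_pos_eq s0), (Rabs_pos_eq rad) by lra.
  pose proof (cis_Lipschitz t t0) as H1. pose proof (zeta_a_le t) as H2.
  pose proof (Rabs_pos (s - s0)). pose proof (Rabs_pos (t - t0)).
  pose proof (Cmod_ge_0 (cis t - cis t0)).
  assert (Rabs (s - s0) * Cmod (zeta t - a) <= Rabs (s - s0) * (2 * rad))%R
    by (apply Rmult_le_compat_l; lra).
  assert (s0 * rad * Cmod (cis t - cis t0) <= (1 * rad) * Rabs (t - t0))%R.
  { apply Rmult_le_compat; [|lra| |lra].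
    - apply Rmult_le_pos; lra.
    - apply Rmult_le_compat_r; lra. }
  nra.
Qed.

(* Integral around [s1,s2] x [t1,t2] of the pullback by [Z] of the form
   h(Z) dZ / (i (Z - a)), up to the factor i. *)
Let form (H : R -> R -> C) (s1 s2 t1 t2 : R) : C :=
  CI (fun s => H s t1 * / RtoC s) s1 s2 + Ci * CI (fun t => H s2 t * k t) t1 t2
  - CI (fun s => H s t2 * / RtoC s) s1 s2 - Ci * CI (fun t => H s1 t * k t) t1 t2.

(** [form] integrates along edges, where one variable is fixed, so continuity in each variable is
    what the integrals require. The bound e <= s stays away from the singular edge s = 0. *)
Let sep_cont (e : R) (H : R -> R -> C) : Prop :=
  (forall s t, (e <= s <= 1)%R -> ccont (fun s => H s t) s) /\
  (forall s t, (e <= s <= 1)%R -> ccont (fun t => H s t) t).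

Let cont_s (e : R) (H : R -> R -> C) (s1 s2 t : R) :
  (0 < e <= s1)%R -> (s2 <= 1)%R -> sep_cont e H ->
  cont_on (fun s => H s t * / RtoC s) s1 s2.
Proof.
  intros He Hs [H1 _] s Hs'. apply ccont_mult; [apply H1; lra|].
  apply ccont_inv; [|apply ccont_R]. intros E. apply RtoC_inj in E. lra.
Qed.

Let cont_t (e : R) (H : R -> R -> C) (s t1 t2 : R) :
  (e <= s <= 1)%R -> sep_cont e H -> cont_on (fun t => H s t * k t) t1 t2.
Proof.
  intros He [_ H2] t Ht. apply ccont_mult; [now apply H2|apply cont_k].
Qed.

Let form_plus (e : R) (H G : R -> R -> C) (s1 s2 t1 t2 : R) :
  (0 < e <= s1)%R -> (s1 <= s2 <= 1)%R -> (t1 <= t2)%R -> sep_cont e H -> sep_cont e G ->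
  form (fun s t => H s t + G s t) s1 s2 t1 t2 = form H s1 s2 t1 t2 + form G s1 s2 t1 t2.
Proof.
  intros He Hs Ht HH HG. unfold form.
  assert (E1 : forall t, CI (fun s => (H s t + G s t) * / RtoC s) s1 s2 =
    CI (fun s => H s t * / RtoC s) s1 s2 + CI (fun s => G s t * / RtoC s) s1 s2).
  { intros t. rewrite <- CI_plus; try (apply (cont_s e); eassumption || lra); try lra.
    apply CI_ext; [lra|]. intros s _. ring. }
  assert (E2 : forall s, (e <= s <= 1)%R -> CI (fun t => (H s t + G s t) * k t) t1 t2 =
    CI (fun t => H s t * k t) t1 t2 + CI (fun t => G s t * k t) t1 t2).
  { intros s Hs'. rewrite <- CI_plus; try (apply (cont_t e); eassumption || lra); try lra.
    apply CI_ext; [lra|]. intros t _. ring. }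
  rewrite !E1, !E2 by lra. ring.
Qed.

Let form_ext (H G : R -> R -> C) (s1 s2 t1 t2 : R) :
  (s1 <= s2)%R -> (t1 <= t2)%R -> (forall s t, H s t = G s t) ->
  form H s1 s2 t1 t2 = form G s1 s2 t1 t2.
Proof.
  intros Hs Ht E. unfold form.
  rewrite (CI_ext (fun s => H s t1 * / RtoC s) (fun s => G s t1 * / RtoC s)),
    (CI_ext (fun s => H s t2 * / RtoC s) (fun s => G s t2 * / RtoC s)),
    (CI_ext (fun t => H s1 t * k t) (fun t => G s1 t * k t)),
    (CI_ext (fun t => H s2 t * k t) (fun t => G s2 t * k t));
    try assumption; try reflexivity; intros x _; now rewrite E.
Qed.

(** The integrand c0 (ds / s + i k dt) + c1 dZ is closed: the c0 terms agree on opposite edges, and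
    dZ integrates to 0 around the contour. This lets [form_local] subtract a first-order Taylor
    polynomial. *)
Let form_affine (c0 c1 : C) (s1 s2 t1 t2 : R) :
  (0 < s1 <= s2)%R -> (t1 <= t2)%R ->
  form (fun s t => c0 + c1 * (Z s t - a)) s1 s2 t1 t2 = 0.
Proof.
  intros Hs Ht. unfold form.
  assert (Hinv : cont_on (fun s => / RtoC s) s1 s2).
  { intros s Hs'. apply ccont_inv; [|apply ccont_R]. intros E. apply RtoC_inj in E. lra. }
  assert (Hnz : forall s, (s1 <= s <= s2)%R -> RtoC s <> 0).
  { intros s Hs' E. apply RtoC_inj in E. lra. }
  assert (E1 : forall t, CI (fun s => (c0 + c1 * (Z s t - a)) * / RtoC s) s1 s2 =
    c0 * CI (fun s => / RtoC s) s1 s2 + RtoC (s2 - s1) * (c1 * (zeta t - a))).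
  { intros t. rewrite <- CI_scal, <- CI_const, <- CI_plus; try lra; try assumption.
    - apply CI_ext; [lra|]. intros s Hs'. unfold Z. field. now apply Hnz.
    - intros s Hs'. apply ccont_mult; [apply ccont_const|now apply Hinv].
    - intros s _. apply ccont_const. }
  assert (E2 : forall s, CI (fun t => (c0 + c1 * (Z s t - a)) * k t) t1 t2 =
    c0 * CI k t1 t2 + c1 * RtoC s * RtoC rad * - Ci * (cis t2 - cis t1)).
  { intros s. rewrite <- CI_cis by assumption.
    rewrite <- !CI_scal, <- CI_plus; try assumption.
    - apply CI_ext; [assumption|]. intros t _.
      replace (c1 * RtoC s * RtoC rad * - Ci * (Ci * cis t)) with
        (c1 * RtoC s * (RtoC rad * cis t)).
      + unfold Z, k. fold (zeta t). field. apply zeta_a_neq.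
      + apply injective_projections; simpl; ring.
    - intros t _. apply ccont_mult; [apply ccont_const|apply cont_k].
    - intros t _. repeat apply ccont_mult; try apply ccont_const. apply ccont_cis.
    - intros t _. apply ccont_mult; [apply ccont_const|apply ccont_cis].
    - intros t _. apply cont_k. }
  rewrite !E1, !E2, RtoC_minus. unfold zeta.
  replace (RtoC rad * cis t1 - a) with (RtoC rad * cis t2 - a - RtoC rad * (cis t2 - cis t1))
    by ring.
  set (w := cis t2 - cis t1).
  apply injective_projections; simpl; ring.
Qed.

Let form_bound (e M : R) (H : R -> R -> C) (s1 s2 t1 t2 : R) :
  (0 < e <= s1)%R -> (s1 <= s2 <= 1)%R -> (t1 <= t2)%R -> sep_cont e H ->
  (forall s t, (s1 <= s <= s2)%R -> (t1 <= t <= t2)%R -> (Cmod (H s t) <= M)%R) ->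
  (Cmod (form H s1 s2 t1 t2) <=
     M * (2 * (/ e + rad / (rad - Cmod a))) * (s2 - s1 + (t2 - t1)))%R.
Proof.
  intros He Hs Ht HH HM.
  set (K := (rad / (rad - Cmod a))%R).
  assert (HK : (0 <= K)%R) by (apply Rlt_le, Rdiv_lt_0_compat; lra).
  assert (Hie : (0 < / e)%R) by (apply Rinv_0_lt_compat; lra).
  assert (HM0 : (0 <= M)%R).
  { eapply Rle_trans; [apply Cmod_ge_0|apply (HM s1 t1); lra]. }
  assert (B1 : forall t, (t1 <= t <= t2)%R ->
    (Cmod (CI (fun s => (H s t * / RtoC s)%C) s1 s2) <= (s2 - s1) * (M * / e))%R).
  { intros t Ht'. apply CI_bound; [lra|apply (cont_s e); eassumption || lra|].
    intros s Hs'. rewrite Cmod_mult, Cmod_inv, Cmod_R, Rabs_pos_eq;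
      [|lra|intros E; apply RtoC_inj in E; lra].
    apply Rmult_le_compat; [apply Cmod_ge_0| |now apply HM|apply Rinv_le_contravar; lra].
    apply Rlt_le, Rinv_0_lt_compat; lra. }
  assert (B2 : forall s, (s1 <= s <= s2)%R ->
    (Cmod (CI (fun t => (H s t * k t)%C) t1 t2) <= (t2 - t1) * (M * K))%R).
  { intros s Hs'. apply CI_bound; [lra|apply (cont_t e); eassumption || lra|].
    intros t Ht'. rewrite Cmod_mult.
    apply Rmult_le_compat; try apply Cmod_ge_0; [now apply HM|apply k_bound]. }
  unfold form, Cminus.
  eapply Rle_trans; [apply Cmod_triangle|].
  eapply Rle_trans; [apply Rplus_le_compat_r, Cmod_triangle|].
  eapply Rle_trans; [apply Rplus_le_compat_r, Rplus_le_compat_r, Cmod_triangle|].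
  rewrite !Cmod_opp, !Cmod_mult, Cmod_Ci.
  pose proof (B1 t1 ltac:(lra)). pose proof (B1 t2 ltac:(lra)).
  pose proof (B2 s1 ltac:(lra)). pose proof (B2 s2 ltac:(lra)).
  assert (0 <= M * / e)%R by (apply Rmult_le_pos; lra).
  assert (0 <= M * K)%R by (apply Rmult_le_pos; lra).
  assert (0 <= M * / e * (t2 - t1))%R by (apply Rmult_le_pos; lra).
  assert (0 <= M * K * (s2 - s1))%R by (apply Rmult_le_pos; lra).
  nra.
Qed.

Variable f : C -> C.
Hypothesis Hf : forall z, (Cmod z <= rad)%R -> exists l, Cis_derive f z l.

Let H (s t : R) : C := f (Z s t).

Let cont_Z_s (s t : R) : ccont (fun s => Z s t) s.
Proof.
  apply ccont_plus; [apply ccont_const|].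
  apply ccont_mult; [apply ccont_R|apply ccont_const].
Qed.

Let cont_Z_t (s t : R) : ccont (fun t => Z s t) t.
Proof.
  apply ccont_plus; [apply ccont_const|].
  apply ccont_mult; [apply ccont_const|apply cont_zeta_a].
Qed.

Let cont_H (e : R) : (0 < e)%R -> sep_cont e H.
Proof.
  intros He. split; intros s t Hs; destruct (Hf (Z s t)) as [l Hl];
    try (apply Z_in; lra); apply Cis_derive_ccont in Hl.
  - apply (ccont_comp f (fun s => Z s t)); [apply cont_Z_s|exact Hl].
  - apply (ccont_comp f (fun t => Z s t)); [apply cont_Z_t|exact Hl].
Qed.

(** After subtraction of the affine part, the integrand is at most eta |Z - Z0|, of the order of the
    size of the rectangle; the length of the contour contributes the second factor. *)
Let form_local (e s0 t0 : R) : (0 < e)%R -> (e <= s0 <= 1)%R ->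
  forall eps, (0 < eps)%R -> exists delta, (0 < delta)%R /\
  forall s1 s2 t1 t2, (e <= s1 <= s0)%R -> (s0 <= s2 <= 1)%R ->
    (t1 <= t0 <= t2)%R -> (s2 - s1 < delta)%R -> (t2 - t1 < delta)%R ->
    (Cmod (form H s1 s2 t1 t2) <= eps * (s2 - s1 + (t2 - t1)) ^ 2)%R.
Proof.
  intros He Hs0 eps Heps.
  set (K := (2 * (/ e + rad / (rad - Cmod a)))%R).
  assert (HK : (0 < K)%R).
  { unfold K. assert (0 < / e)%R by (apply Rinv_0_lt_compat; lra).
    assert (0 < rad / (rad - Cmod a))%R by (apply Rdiv_lt_0_compat; lra). lra. }
  destruct (Hf (Z s0 t0)) as [l Hl]; [apply Z_in; lra|].
  (* Chosen so that eta * 2 rad * K = eps, where 2 rad is the Lipschitz constant of [Z] and K the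
     constant of [form_bound]. *)
  set (eta := (eps / (2 * rad * K))%R).
  assert (Heta : (0 < eta)%R).
  { apply Rdiv_lt_0_compat; [lra|]. apply Rmult_lt_0_compat; lra. }
  destruct (proj1 (Cis_derive_eps _ _ _) Hl eta Heta) as (d & Hd & HdE).
  (* Both sides being shorter than d / (4 rad), |Z - Z0| < 2 rad * 2 * d / (4 rad) = d. *)
  exists (d / (4 * rad))%R. split; [apply Rdiv_lt_0_compat; lra|].
  intros s1 s2 t1 t2 Hs1 Hs2 Ht Hds Hdt.
  set (A := fun s t => (f (Z s0 t0) - l * (Z s0 t0 - a)) + l * (Z s t - a)).
  assert (HA : sep_cont e A).
  { split; intros s t _; apply ccont_plus; try apply ccont_const;
      (apply ccont_mult; [apply ccont_const|]); (apply ccont_minus; [|apply ccont_const]).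
    - apply cont_Z_s.
    - apply cont_Z_t. }
  assert (HE : sep_cont e (fun s t => H s t - A s t)).
  { destruct (cont_H e He) as [H1 H2]. destruct HA as [A1 A2].
    split; intros s t Hs; apply ccont_minus; auto. }
  assert (Esum : form H s1 s2 t1 t2 =
    form A s1 s2 t1 t2 + form (fun s t => H s t - A s t) s1 s2 t1 t2).
  { rewrite <- (form_plus e) by (assumption || lra). apply form_ext; [lra|lra|].
    intros s t. ring. }
  rewrite Esum. unfold A at 1. rewrite form_affine by lra. rewrite Cplus_0_l.
  set (sz := (s2 - s1 + (t2 - t1))%R).
  assert (Hsz : (0 <= sz)%R) by (unfold sz; lra).
  apply Rle_trans with (eta * (2 * rad * sz) * K * sz)%R.
  - apply form_bound; try assumption; try lra.
    intros s t Hs Ht'. unfold H, A.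
    replace (f (Z s t) - (f (Z s0 t0) - l * (Z s0 t0 - a) + l * (Z s t - a))) with
      (f (Z s t) - f (Z s0 t0) - l * (Z s t - Z s0 t0)) by ring.
    assert (HZ : (Cmod (Z s t - Z s0 t0) <= 2 * rad * sz)%R).
    { eapply Rle_trans; [apply Z_Lipschitz; lra|].
      apply Rmult_le_compat_l; [lra|]. unfold sz.
      apply Rplus_le_compat; apply Rabs_le; lra. }
    eapply Rle_trans; [apply HdE|].
    + eapply Rle_lt_trans; [exact HZ|].
      apply Rlt_le_trans with (2 * rad * (2 * (d / (4 * rad))))%R.
      * apply Rmult_lt_compat_l; [lra|]. unfold sz. lra.
      * right. field. lra.
    + apply Rmult_le_compat_l; lra.
  - right. unfold eta. field. lra.
Qed.

Let J (s : R) : C := CI (fun t => H s t * k t) 0 (2 * PI).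

(** The form vanishes on [e,1] x [0, 2 PI], and its edges t = 0 and t = 2 PI cancel by periodicity;
    what is left is i (J 1 - J e). *)
Let J_const (e : R) : (0 < e <= 1)%R -> J 1 = J e.
Proof.
  intros He.
  assert (HPI : (0 <= 2 * PI)%R) by (pose proof PI_RGT_0; lra).
  assert (HH : sep_cont e H) by (apply cont_H; lra).
  assert (E : form H e 1 0 (2 * PI) = 0).
  { apply (additive_rect_zero (form H)); [lra|lra| | |].
    - intros s1 s2 s3 t1 t2 H1 H2 H3 H4. unfold form.
      rewrite (CI_Chasles (fun s => H s t1 * / RtoC s) s1 s2 s3),
        (CI_Chasles (fun s => H s t2 * / RtoC s) s1 s2 s3);
        try (apply (cont_s e); eassumption || lra); try lra.
      ring.
    - intros s1 s2 t1 t2 t3 H1 H2 H3 H4. unfold form.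
      rewrite (CI_Chasles (fun t => H s1 t * k t) t1 t2 t3),
        (CI_Chasles (fun t => H s2 t * k t) t1 t2 t3);
        try (apply (cont_t e); eassumption || lra); try lra.
      ring.
    - intros s0 t0 Hs0 Ht0 eps Heps.
      destruct (form_local e s0 t0 ltac:(lra) Hs0 eps Heps) as (delta & Hd & HL).
      exists delta. split; [exact Hd|]. intros s1 s2 t1 t2 H1 H2 H3 H4. apply HL; lra. }
  unfold form in E.
  assert (Eper : forall s, H s (2 * PI) = H s 0).
  { intros s. unfold H, Z, zeta, cis.
    now rewrite cos_2PI, sin_2PI, cos_0, sin_0. }
  rewrite (CI_ext (fun s => H s (2 * PI)%R * / RtoC s) (fun s => H s 0%R * / RtoC s)) in E;
    [|lra|intros s _; now rewrite Eper].
  fold (J 1) (J e) in E.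
  assert (E' : Ci * (J 1 - J e) = 0) by (rewrite <- E; ring).
  apply Cminus_0_eq. destruct (Ceq_dec (J 1 - J e) 0) as [|n]; [assumption|].
  exfalso. revert E'. apply Cmult_neq_0; [|exact n].
  intros E'. apply (f_equal Im) in E'. simpl in E'. lra.
Qed.

(** J 1 is the integral over the circle and J e tends to f a times the integral of [k] as e tends to
    0. The integral of [k] is left unevaluated here, because [CI_kernel] computes it by applying
    this very lemma to another function. *)
Lemma Cauchy_kernel :
  CI (fun t => f (RtoC rad * cis t) * (RtoC rad * cis t / (RtoC rad * cis t - a))) 0 (2 * PI)
  = f a * CI (fun t => RtoC rad * cis t / (RtoC rad * cis t - a)) 0 (2 * PI).
Proof.
  assert (HPI : (0 < 2 * PI)%R) by (pose proof PI_RGT_0; lra).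
  transitivity (J 1).
  { apply CI_ext; [lra|]. intros t _. unfold H, Z, k, zeta.
    f_equal. f_equal. ring. }
  apply Cminus_0_eq, Cmod_eq_0.
  set (D := Cmod _).
  destruct (Rle_lt_or_eq_dec 0 D (Cmod_ge_0 _)) as [HD|]; [exfalso|easy].
  set (K := (rad / (rad - Cmod a))%R).
  assert (HK : (0 < K)%R) by (apply Rdiv_lt_0_compat; lra).
  destruct (Hf a) as [l Hl]; [lra|]. apply Cis_derive_ccont in Hl.
  (* With this eps the estimate 2 PI * eps * K equals D / 2, which contradicts D > 0. *)
  set (eps := (D / (2 * (2 * PI * K)))%R).
  assert (Heps : (0 < eps)%R).
  { apply Rdiv_lt_0_compat; [lra|]. pose proof (Rmult_lt_0_compat _ _ HPI HK). lra. }
  destruct (proj1 (locally_CU _ _) (Hl eps Heps)) as (d & Hd & HdE).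
  (* The contracted circle has |Z - a| = e |zeta - a| <= d / (4 rad) * 2 rad < d. *)
  set (e := Rmin 1 (d / (4 * rad))).
  assert (He : (0 < e)%R) by (apply Rmin_pos; [lra|apply Rdiv_lt_0_compat; lra]).
  assert (He1 : (e <= 1)%R) by apply Rmin_l.
  assert (Hed : (e <= d / (4 * rad))%R) by apply Rmin_r.
  assert (HJ : (D <= 2 * PI * (eps * K))%R); [|unfold eps in HJ].
  { unfold D. rewrite (J_const e) by lra. unfold J. fold k.
    change (fun t => RtoC rad * cis t / (RtoC rad * cis t - a)) with k.
    assert (HcH : cont_on (fun t => H e t * k t) 0 (2 * PI)).
    { apply (cont_t e); [lra|]. now apply cont_H. }
    rewrite <- CI_scal, <- CI_minus; try assumption; try lra.
    - replace (2 * PI * (eps * K))%R with ((2 * PI - 0) * (eps * K))%R by ring.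
      apply CI_bound; [lra| |].
      + intros t Ht. apply ccont_minus; [now apply HcH|].
        apply ccont_mult; [apply ccont_const|apply cont_k].
      + intros t _. replace (H e t * k t - f a * k t) with ((H e t - f a) * k t) by ring.
        rewrite Cmod_mult. apply Rmult_le_compat; try apply Cmod_ge_0; [|apply k_bound].
        apply Rlt_le, HdE. unfold Z.
        replace (a + RtoC e * (zeta t - a) - a) with (RtoC e * (zeta t - a)) by ring.
        rewrite Cmod_mult, Cmod_R, Rabs_pos_eq by lra.
        apply Rle_lt_trans with (d / (4 * rad) * (2 * rad))%R.
        * apply Rmult_le_compat; try lra; [apply Cmod_ge_0|apply zeta_a_le].
        * replace (d / (4 * rad) * (2 * rad))%R with (d / 2)%R by (field; lra). lra.
    - intros t _. apply ccont_mult; [apply ccont_const|apply cont_k].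
    - intros t _. apply cont_k. }
  replace (2 * PI * (D / (2 * (2 * PI * K)) * K))%R with (D / 2)%R in HJ
    by (field; pose proof PI_RGT_0; lra).
  lra.
Qed.

End CauchyForm.

Lemma Cmult_cancel_l (c u v : C) : c <> 0 -> c * u = c * v -> u = v.
Proof.
  intros Hc H. replace u with (/ c * (c * u)) by (field; exact Hc).
  rewrite H. field. exact Hc.
Qed.

Definition circ (rad t : R) : C := RtoC rad * cis t.

Lemma Cmod_circ (rad t : R) : (0 <= rad)%R -> Cmod (circ rad t) = rad.
Proof.
  intros H. unfold circ. rewrite Cmod_mult, Cmod_cis, Cmod_R, Rabs_pos_eq by assumption. ring.
Qed.

Lemma ccont_circ (rad t : R) : ccont (circ rad) t.
Proof. apply ccont_mult; [apply ccont_const|apply ccont_cis]. Qed.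

Lemma circ_minus_ge (rad : R) (z : C) (t : R) :
  (0 <= rad)%R -> (rad - Cmod z <= Cmod (circ rad t - z))%R.
Proof. intros H. rewrite <- (Cmod_circ rad t H) at 1. apply Cmod_triangle_inv. Qed.

Lemma circ_minus_neq (rad : R) (z : C) (t : R) :
  (Cmod z < rad)%R -> circ rad t - z <> 0.
Proof.
  intros Hz. pose proof (Cmod_ge_0 z). apply Cmod_gt_0.
  pose proof (circ_minus_ge rad z t ltac:(lra)). lra.
Qed.

Lemma circ_minus_le (rad : R) (z : C) (t : R) :
  (Cmod z < rad)%R -> (Cmod (circ rad t - z) <= 2 * rad)%R.
Proof.
  intros Hz. pose proof (Cmod_ge_0 z).
  eapply Rle_trans; [apply Cmod_triangle|]. rewrite Cmod_opp, Cmod_circ by lra. lra.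
Qed.

Lemma ccont_circ_minus (rad : R) (z : C) (t : R) : ccont (fun t => circ rad t - z) t.
Proof. apply ccont_minus; [apply ccont_circ|apply ccont_const]. Qed.

Lemma two_PI_pos : (0 < 2 * PI)%R.
Proof. pose proof PI_RGT_0. lra. Qed.

(* On the circle, [z / (z - a)] is the conjugate of [1 / (1 - conj a z / rad^2)],
   which is holomorphic on the closed disc and has mean value 1. *)
Lemma CI_kernel (rad : R) (a : C) : (Cmod a < rad)%R ->
  CI (fun t => circ rad t / (circ rad t - a)) 0 (2 * PI) = RtoC (2 * PI).
Proof.
  intros Ha. pose proof (Cmod_ge_0 a). pose proof two_PI_pos.
  assert (Hrad : RtoC rad <> 0) by (intros E; apply RtoC_inj in E; lra).
  set (d := fun z => 1 - Cconj a / (RtoC rad * RtoC rad) * z).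
  assert (Hd : forall z, (Cmod z <= rad)%R -> d z <> 0).
  { intros z Hz E. apply Cminus_0_eq in E. symmetry in E. apply (f_equal Cmod) in E.
    rewrite Cmod_1, Cmod_mult, Cmod_div, Cmod_conj, Cmod_mult, Cmod_R, Rabs_pos_eq in E;
      [|lra|now apply Cmult_neq_0].
    assert (Cmod a / (rad * rad) * Cmod z <= Cmod a / (rad * rad) * rad)%R.
    { apply Rmult_le_compat_l; [|lra]. apply Rmult_le_pos; [lra|].
      apply Rlt_le, Rinv_0_lt_compat. nra. }
    replace (Cmod a / (rad * rad) * rad)%R with (Cmod a / rad)%R in H1 by (field; lra).
    assert (Cmod a / rad < 1)%R by (apply Rlt_div_l; lra). lra. }
  assert (Hdd : forall z, Cis_derive d z (0 - Cconj a / (RtoC rad * RtoC rad) * 1)).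
  { intros z. apply Cis_derive_minus; [apply Cis_derive_const|].
    apply Cis_derive_scal, Cis_derive_id. }
  (* At centre 0 the kernel is identically 1, so this is the mean value property of 1 / d, whose
     value at 0 is 1. *)
  pose proof (Cauchy_kernel rad 0 ltac:(rewrite Cmod_0; lra) (fun z => / d z)) as HC.
  lapply HC; clear HC; [intros HC|].
  2:{ intros z Hz. eexists. apply Cis_derive_inv; [now apply Hd|apply Hdd]. }
  fold (circ rad) in HC.
  assert (Hcz : forall t, circ rad t <> 0).
  { intros t E. pose proof (Cmod_circ rad t ltac:(lra)) as E'. rewrite E, Cmod_0 in E'. lra. }
  assert (Hdcont : cont_on (fun t => / d (circ rad t)) 0 (2 * PI)).
  { intros t _. apply ccont_inv.
    - apply Hd. rewrite Cmod_circ; lra.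
    - apply ccont_minus; [apply ccont_const|].
      apply ccont_mult; [apply ccont_const|apply ccont_circ]. }
  assert (HC' : CI (fun t => / d (circ rad t)) 0 (2 * PI) = RtoC (2 * PI)).
  { transitivity (/ d 0 * CI (fun _ => 1) 0 (2 * PI)).
    - etransitivity; [etransitivity; [|exact HC]|].
      + apply CI_ext; [lra|]. intros t _. fold (circ rad t).
        replace (circ rad t - 0) with (circ rad t) by ring.
        assert (d (circ rad t) <> 0) by (apply Hd; rewrite Cmod_circ; lra).
        pose proof (Hcz t). field. now split.
      + f_equal. apply CI_ext; [lra|]. intros t _. fold (circ rad t).
        replace (circ rad t - 0) with (circ rad t) by ring. field. apply Hcz.
    - rewrite CI_const, Rminus_0_r by lra.
      replace (d 0) with (RtoC 1) by (unfold d; ring). field. }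
  transitivity (Cconj (RtoC (2 * PI))); [|apply injective_projections; simpl; ring].
  rewrite <- HC', <- CI_conj by (assumption || lra).
  apply CI_ext; [lra|]. intros t _.
  rewrite Cinv_conj by (apply Hd; rewrite Cmod_circ; lra).
  (* On the circle conjugation is the inversion zeta -> rad^2 / zeta, which turns the conjugate of 1
     / d into zeta / (zeta - a). *)
  assert (Hcc : Cconj (circ rad t) = RtoC rad * RtoC rad / circ rad t).
  { apply (Cmult_cancel_l (circ rad t)); [apply Hcz|].
    rewrite <- Cmod2_conj, Cmod_circ by lra.
    replace (circ rad t * (RtoC rad * RtoC rad / circ rad t)) with (RtoC rad * RtoC rad)
      by (field; apply Hcz).
    rewrite <- RtoC_mult. f_equal. ring. }
  unfold d. rewrite Cminus_conj, Cmult_conj, Cdiv_conj, Cconj_conj, Hcc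
    by now apply Cmult_neq_0.
  rewrite Cmult_conj.
  replace (Cconj (RtoC rad)) with (RtoC rad) by (apply injective_projections; simpl; ring).
  replace (Cconj 1) with (RtoC 1) by (apply injective_projections; simpl; ring).
  pose proof (circ_minus_neq rad a t Ha). pose proof (Hcz t).
  field. repeat split; assumption.
Qed.

Lemma Cauchy_formula (rad : R) (a : C) (f : C -> C) : (Cmod a < rad)%R ->
  (forall z, (Cmod z <= rad)%R -> exists l, Cis_derive f z l) ->
  CI (fun t => f (circ rad t) * (circ rad t / (circ rad t - a))) 0 (2 * PI)
  = f a * RtoC (2 * PI).
Proof.
  intros Ha Hf. rewrite <- (CI_kernel rad a Ha). now apply Cauchy_kernel.
Qed.

(** Differentiation under the integral sign from a quadratic remainder uniform in t. For the Cauchy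
    kernels this remainder comes from an explicit algebraic identity. *)
Lemma CI_derive_param (k : C -> R -> C) (k' : R -> C) (a b M r : R) (z : C) :
  (a <= b)%R -> (0 < r)%R -> (0 <= M)%R ->
  (forall y, (Cmod (y - z) < r)%R -> cont_on (k y) a b) -> cont_on k' a b ->
  (forall y t, (Cmod (y - z) < r)%R -> (a <= t <= b)%R ->
     (Cmod (k y t - k z t - (y - z) * k' t) <= M * (Cmod (y - z)) ^ 2)%R) ->
  Cis_derive (fun y => CI (k y) a b) z (CI k' a b).
Proof.
  intros Hab Hr HM Hk Hk' HE. apply Cis_derive_eps. intros eps Heps.
  set (N := ((b - a) * M + 1)%R).
  assert (HN : (0 < N)%R) by (unfold N; nra).
  exists (Rmin r (eps / N)). split; [apply Rmin_pos; [lra|now apply Rdiv_lt_0_compat]|].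
  intros y Hy.
  assert (Hyr : (Cmod (y - z) < r)%R) by (eapply Rlt_le_trans; [exact Hy|apply Rmin_l]).
  assert (Hye : (Cmod (y - z) < eps / N)%R) by (eapply Rlt_le_trans; [exact Hy|apply Rmin_r]).
  assert (Hz : (Cmod (z - z) < r)%R)
    by (replace (z - z) with (RtoC 0) by ring; now rewrite Cmod_0).
  rewrite Cmult_comm, <- CI_scal, <- CI_minus, <- CI_minus; auto.
  - pose proof (Cmod_ge_0 (y - z)) as H0.
    eapply Rle_trans; [apply (CI_bound _ a b (M * Cmod (y - z) ^ 2)); [assumption| |]|].
    + intros t Ht. apply ccont_minus; [apply ccont_minus; [apply (Hk y)|apply (Hk z)]; auto|].
      apply ccont_mult; [apply ccont_const|now apply Hk'].
    + intros t Ht. now apply HE.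
    + apply Rle_trans with (N * Cmod (y - z) * Cmod (y - z))%R.
      { unfold N. nra. }
      apply Rmult_le_compat_r; [assumption|].
      apply (Rmult_lt_compat_l N) in Hye; [|assumption].
      replace (N * (eps / N))%R with eps in Hye by (field; lra). lra.
  - intros t Ht. apply ccont_minus; [apply (Hk y)|apply (Hk z)]; auto.
  - intros t Ht. apply ccont_mult; [apply ccont_const|now apply Hk'].
Qed.

(** * Analyticity of derivatives and the Schwarz lemma *)

(** A Cauchy transform taken against dt rather than d zeta: in [analytic_factor] the missing factor
    zeta disappears through zeta / (zeta - z) - 1 = z / (zeta - z). *)
Definition Ctransform (phi : R -> C) (rad : R) (n : nat) (z : C) : C :=
  CI (fun t => phi t / (circ rad t - z) ^ n) 0 (2 * PI).

Section CauchyTransform.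
Variables (phi : R -> C) (rad : R).
Hypothesis Hphi : cont_on phi 0 (2 * PI).

Let cont_kernel (n : nat) (y : C) : (Cmod y < rad)%R ->
  cont_on (fun t => phi t / (circ rad t - y) ^ n) 0 (2 * PI).
Proof.
  intros Hy t Ht. apply ccont_div; [|now apply Hphi|].
  - now apply Cpow_nz, circ_minus_neq.
  - apply ccont_pow, ccont_circ_minus.
Qed.

Let near (y z : C) : (Cmod (y - z) < (rad - Cmod z) / 2)%R ->
  (Cmod y <= Cmod z + (rad - Cmod z) / 2)%R.
Proof.
  intros H. pose proof (Cmod_triangle_inv y z). lra.
Qed.

Let inv_bound (z : C) : (Cmod z < rad)%R -> exists m, (0 < m)%R /\
  forall y t, (Cmod (y - z) < (rad - Cmod z) / 2)%R -> (Cmod (/ (circ rad t - y)) <= m)%R.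
Proof.
  intros Hz. pose proof (Cmod_ge_0 z).
  exists (/ ((rad - Cmod z) / 2))%R. split; [apply Rinv_0_lt_compat; lra|].
  intros y t Hy%near. pose proof (circ_minus_ge rad y t ltac:(lra)).
  rewrite Cmod_inv by (apply circ_minus_neq; lra).
  apply Rinv_le_contravar; lra.
Qed.

Lemma Ctransform_derive1 (z : C) : (Cmod z < rad)%R ->
  Cis_derive (Ctransform phi rad 1) z (Ctransform phi rad 2 z).
Proof.
  intros Hz. pose proof (Cmod_ge_0 z). pose proof two_PI_pos.
  destruct (cont_on_bounded _ _ _ Hphi) as (N & HN & HNb).
  destruct (inv_bound z Hz) as (m & Hm & Hmb).
  apply (CI_derive_param _ _ _ _ (N * (m * (m * m))) ((rad - Cmod z) / 2)); try lra.
  - apply Rlt_le. repeat apply Rmult_lt_0_compat; assumption.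
  - intros y Hy%near. apply cont_kernel. lra.
  - now apply cont_kernel.
  - intros y t Hy Ht. pose proof (near _ _ Hy).
    assert (Hu := circ_minus_neq rad y t ltac:(lra)).
    assert (Hv := circ_minus_neq rad z t Hz).
    pose proof (Hmb y t Hy) as B1.
    assert (B2 : (Cmod (/ (circ rad t - z)) <= m)%R).
    { apply Hmb. replace (z - z) with (RtoC 0) by ring. rewrite Cmod_0. lra. }
    (* With u = zeta - y and v = zeta - z, so that v - u = y - z: 1/u - 1/v - (v - u)/v^2 = (v -
       u)^2 / (u v^2). *)
    replace (phi t / (circ rad t - y) ^ 1 - phi t / (circ rad t - z) ^ 1 -
       (y - z) * (phi t / (circ rad t - z) ^ 2)) with
      (phi t * (/ (circ rad t - y) * (/ (circ rad t - z) * / (circ rad t - z)))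
        * (y - z) ^ 2) by (simpl; field; auto).
    rewrite Cmod_mult, Cmod_pow. apply Rmult_le_compat_r; [apply pow2_ge_0|].
    rewrite !Cmod_mult.
    repeat apply Rmult_le_compat; auto using Cmod_ge_0, Rmult_le_pos.
Qed.

Lemma Ctransform_derive2 (z : C) : (Cmod z < rad)%R ->
  Cis_derive (Ctransform phi rad 2) z (2 * Ctransform phi rad 3 z).
Proof.
  intros Hz. pose proof (Cmod_ge_0 z). pose proof two_PI_pos.
  destruct (cont_on_bounded _ _ _ Hphi) as (N & HN & HNb).
  destruct (inv_bound z Hz) as (m & Hm & Hmb).
  unfold Ctransform. rewrite <- CI_scal by (try apply cont_kernel; lra).
  apply (CI_derive_param _ _ _ _ (N * (m * m * (m * m * m)) * (6 * rad))
    ((rad - Cmod z) / 2)); try lra.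
  - apply Rlt_le. repeat apply Rmult_lt_0_compat; try assumption; lra.
  - intros y Hy%near. apply cont_kernel. lra.
  - intros t Ht. apply ccont_mult; [apply ccont_const|now apply cont_kernel].
  - intros y t Hy Ht. pose proof (near _ _ Hy).
    assert (Hu := circ_minus_neq rad y t ltac:(lra)).
    assert (Hv := circ_minus_neq rad z t Hz).
    pose proof (Hmb y t Hy) as B1.
    assert (B2 : (Cmod (/ (circ rad t - z)) <= m)%R).
    { apply Hmb. replace (z - z) with (RtoC 0) by ring. rewrite Cmod_0. lra. }
    (* In the same notation, 1/u^2 - 1/v^2 - 2 (v - u)/v^3 = (v - u)^2 (v + 2 u) / (u^2 v^3); the
       factor v + 2 u accounts for the bound 6 rad. *)
    replace (phi t / (circ rad t - y) ^ 2 - phi t / (circ rad t - z) ^ 2 -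
       (y - z) * (2 * (phi t / (circ rad t - z) ^ 3))) with
      (phi t * (/ (circ rad t - y) * / (circ rad t - y) *
         (/ (circ rad t - z) * / (circ rad t - z) * / (circ rad t - z)))
        * ((circ rad t - z) + ((circ rad t - y) + (circ rad t - y)))
        * (y - z) ^ 2) by (simpl; field; auto).
    rewrite Cmod_mult, Cmod_pow. apply Rmult_le_compat_r; [apply pow2_ge_0|].
    rewrite Cmod_mult.
    apply Rmult_le_compat; try apply Cmod_ge_0.
    + rewrite !Cmod_mult.
      repeat apply Rmult_le_compat; auto 10 using Cmod_ge_0, Rmult_le_pos.
    + pose proof (circ_minus_le rad y t ltac:(lra)). pose proof (circ_minus_le rad z t Hz).
      eapply Rle_trans; [apply Cmod_triangle|].
      pose proof (Cmod_triangle (circ rad t - y) (circ rad t - y)). lra.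
Qed.

End CauchyTransform.

Lemma analytic_D_derive (f : C -> C) (z : C) :
  analytic_D f -> inD z -> exists l, Cis_derive f z l.
Proof. intros Hf Hz. exact (Hf z Hz). Qed.

(** Cauchy's formula at z minus the one at 0 reads 2 PI f(z) = z times the Cauchy transform of f, so
    q is given by an integral also at 0 and can be differentiated under it. Two derivatives are
    recorded because 1 + z q'/q has to be differentiable in [analytic_zfpf]. *)
Lemma analytic_factor (f : C -> C) (rad : R) :
  analytic_D f -> f 0 = 0 -> (0 < rad < 1)%R ->
  exists q q' q'' : C -> C, forall z, (Cmod z < rad)%R ->
    f z = z * q z /\ Cis_derive q z (q' z) /\ Cis_derive q' z (q'' z).
Proof.
  intros Hf Hf0 Hrad. pose proof two_PI_pos.
  assert (Hder : forall z, (Cmod z <= rad)%R -> exists l, Cis_derive f z l).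
  { intros z Hz. apply analytic_D_derive; [assumption|]. unfold inD. lra. }
  set (phi := fun t => f (circ rad t)).
  assert (Hphi : cont_on phi 0 (2 * PI)).
  { intros t _. destruct (Hder (circ rad t)) as [l Hl]; [rewrite Cmod_circ; lra|].
    apply (ccont_comp f (circ rad)); [apply ccont_circ|].
    now apply Cis_derive_ccont in Hl. }
  assert (Hpi : RtoC (2 * PI) <> 0) by (intros E; apply RtoC_inj in E; lra).
  exists (fun z => / RtoC (2 * PI) * Ctransform phi rad 1 z),
    (fun z => / RtoC (2 * PI) * Ctransform phi rad 2 z),
    (fun z => / RtoC (2 * PI) * (2 * Ctransform phi rad 3 z)).
  intros z Hz. split; [|split].
  - apply (Cmult_cancel_l (RtoC (2 * PI))); [assumption|].
    rewrite Cmult_comm, <- (Cauchy_formula rad z f Hz Hder).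
    transitivity (z * Ctransform phi rad 1 z); [|field; assumption].
    assert (H00 : (Cmod 0 < rad)%R) by (rewrite Cmod_0; lra).
    assert (Hk : forall y, (Cmod y < rad)%R ->
      cont_on (fun t => f (circ rad t) * (circ rad t / (circ rad t - y))) 0 (2 * PI)).
    { intros y Hy t Ht. apply ccont_mult; [now apply Hphi|].
      apply ccont_div; [now apply circ_minus_neq|apply ccont_circ|apply ccont_circ_minus]. }
    transitivity (CI (fun t => f (circ rad t) * (circ rad t / (circ rad t - z))) 0 (2 * PI)
      - CI (fun t => f (circ rad t) * (circ rad t / (circ rad t - 0))) 0 (2 * PI)).
    { rewrite (Cauchy_formula rad 0 f H00 Hder), Hf0. ring. }
    rewrite <- CI_minus by (try apply Hk; assumption || lra).
    unfold Ctransform. rewrite <- CI_scal.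
    + apply CI_ext; [lra|]. intros t _. unfold phi.
      pose proof (circ_minus_neq rad z t Hz). pose proof (circ_minus_neq rad 0 t H00) as Hc0.
      replace (circ rad t - 0) with (circ rad t) in * by ring.
      simpl. field. now split.
    + lra.
    + intros t Ht. apply ccont_div; [|now apply Hphi|].
      * now apply Cpow_nz, circ_minus_neq.
      * apply ccont_pow, ccont_circ_minus.
  - apply Cis_derive_scal. now apply Ctransform_derive1.
  - apply Cis_derive_scal. now apply Ctransform_derive2.
Qed.

Lemma ex_Cis_derive_pow (f : C -> C) (z : C) (n : nat) :
  (exists l, Cis_derive f z l) -> exists l, Cis_derive (fun y => f y ^ n) z l.
Proof.
  intros [l Hl]. induction n as [|n [m IH]]; simpl.
  - eexists. apply Cis_derive_const.
  - eexists. now apply Cis_derive_mult; [exact Hl|exact IH].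
Qed.

(* Landau's trick: applying Cauchy's formula to the powers of [w z / z] and taking
   n-th roots replaces the maximum principle. *)
Lemma Schwarz_disc (w : C -> C) (a : C) :
  analytic_D w -> (forall z, inD z -> inD (w z)) -> w 0 = 0 -> inD a ->
  (Cmod (w a) <= Cmod a)%R.
Proof.
  intros Hw HD Hw0 Ha. unfold inD in *. pose proof two_PI_pos.
  destruct (Ceq_dec a 0) as [->|Ha0]; [rewrite Hw0; lra|].
  apply Cmod_gt_0 in Ha0.
  destruct (Rle_or_lt (Cmod (w a)) (Cmod a)) as [|Hlt]; [assumption|exfalso].
  specialize (HD a Ha) as HDa.
  assert (Hx1 : (Cmod a / Cmod (w a) < 1)%R) by (apply Rlt_div_l; lra).
  assert (Hx0 : (Cmod a < Cmod a / Cmod (w a))%R) by (apply Rlt_div_r; nra).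
  (* If |w a| > |a|, then rad lies strictly between |a| / |w a| and 1, so rad * |q a| > 1. The
     larger rad' is needed because Cauchy's formula asks for q on the closed disc of radius rad. *)
  set (rad := ((Cmod a / Cmod (w a) + 1) / 2)%R).
  set (rad' := ((rad + 1) / 2)%R).
  destruct (analytic_factor w rad' Hw Hw0 ltac:(unfold rad', rad; lra))
    as (q & q' & q'' & Hq).
  assert (Hrad : (Cmod a < rad < 1)%R) by (unfold rad; lra).
  assert (Hrr : (rad < rad')%R) by (unfold rad'; lra).
  assert (Hqa : Cmod (w a) = (Cmod a * Cmod (q a))%R).
  { rewrite (proj1 (Hq a ltac:(lra))) at 1. apply Cmod_mult. }
  assert (Hx : (1 < rad * Cmod (q a))%R).
  { apply Rmult_lt_reg_l with (Cmod a); [lra|].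
    replace (Cmod a * (rad * Cmod (q a)))%R with (rad * Cmod (w a))%R by (rewrite Hqa; ring).
    replace (Cmod a * 1)%R with (Cmod a / Cmod (w a) * Cmod (w a))%R by (field; lra).
    apply Rmult_lt_compat_r; [lra|]. unfold rad. lra. }
  set (K := (rad / (rad - Cmod a))%R).
  (* On the circle |q| = |w| / rad < 1 / rad, hence |q a|^n <= K / rad^n with K independent of n; a
     number greater than 1 cannot have bounded powers. *)
  assert (Hbound : forall n, ((rad * Cmod (q a)) ^ n <= K)%R).
  { intros n.
    assert (Hqn : forall z, (Cmod z <= rad)%R -> exists l, Cis_derive (fun y => q y ^ n) z l).
    { intros z Hz. apply ex_Cis_derive_pow. exists (q' z). apply Hq. lra. }
    pose proof (Cauchy_formula rad a _ (proj1 Hrad) Hqn) as HC. simpl in HC.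
    apply (f_equal Cmod) in HC. rewrite Cmod_mult, Cmod_pow, Cmod_R, Rabs_pos_eq in HC by lra.
    assert (HB : (Cmod (q a) ^ n * (2 * PI) <= (2 * PI - 0) * ((/ rad) ^ n * K))%R).
    { rewrite <- HC. apply CI_bound; [lra| |].
      - intros t _. apply ccont_mult.
        + destruct (Hqn (circ rad t)) as [l Hl]; [rewrite Cmod_circ; lra|].
          apply (ccont_comp (fun y => q y ^ n) (circ rad)); [apply ccont_circ|].
          now apply Cis_derive_ccont in Hl.
        + apply ccont_div; [apply circ_minus_neq; lra|apply ccont_circ|apply ccont_circ_minus].
      - intros t _. rewrite Cmod_mult, Cmod_pow, Cmod_div, Cmod_circ
          by (try apply circ_minus_neq; lra).
        assert (Hc : (Cmod (circ rad t) = rad)%R) by (apply Cmod_circ; lra).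
        apply Rmult_le_compat.
        + apply pow_le, Cmod_ge_0.
        + apply Rmult_le_pos; [lra|]. apply Rlt_le, Rinv_0_lt_compat, Cmod_gt_0.
          apply circ_minus_neq; lra.
        + apply pow_incr. split; [apply Cmod_ge_0|].
          pose proof (proj1 (Hq (circ rad t) ltac:(lra))) as E.
          apply (f_equal Cmod) in E. rewrite Cmod_mult, Hc in E.
          pose proof (HD (circ rad t) ltac:(lra)).
          apply Rmult_le_reg_l with rad; [lra|]. rewrite Rinv_r by lra. lra.
        + apply Rmult_le_compat_l; [lra|]. apply Rinv_le_contravar; [lra|].
          apply circ_minus_ge. lra. }
    rewrite Rpow_mult_distr.
    apply Rmult_le_reg_r with ((/ rad) ^ n * (2 * PI))%R.
    { apply Rmult_lt_0_compat; [|lra]. apply pow_lt, Rinv_0_lt_compat. lra. }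
    replace (rad ^ n * Cmod (q a) ^ n * ((/ rad) ^ n * (2 * PI)))%R with
      ((rad * / rad) ^ n * (Cmod (q a) ^ n * (2 * PI)))%R by (rewrite Rpow_mult_distr; ring).
    rewrite Rinv_r, pow1 by lra. lra. }
  destruct (Pow_x_infinity (rad * Cmod (q a)) ltac:(rewrite Rabs_pos_eq; lra) (K + 1)%R)
    as [n Hn].
  specialize (Hn n (Nat.le_refl n)). specialize (Hbound n).
  rewrite Rabs_pos_eq in Hn by (apply pow_le; lra). lra.
Qed.

(** * Exponential, logarithm, square root *)

Definition cexp (z : C) : C := RtoC (exp (Re z)) * cis (Im z).

Lemma cexp_plus (z w : C) : cexp (z + w) = cexp z * cexp w.
Proof.
  unfold cexp, cis, Re, Im. simpl. rewrite exp_plus, cos_plus, sin_plus.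
  apply injective_projections; simpl; ring.
Qed.

Lemma cexp_0 : cexp 0 = 1.
Proof.
  unfold cexp, cis. simpl. rewrite exp_0, cos_0, sin_0.
  apply injective_projections; simpl; ring.
Qed.

Lemma cexp_neq_0 (z : C) : cexp z <> 0.
Proof.
  apply Cmod_gt_0. unfold cexp. rewrite Cmod_mult, Cmod_cis, Cmod_R.
  pose proof (exp_pos (Re z)). rewrite Rabs_pos_eq; lra.
Qed.

Lemma is_derive_eps (f : R -> R) (x l : R) : is_derive f x l ->
  forall eps, (0 < eps)%R -> exists d, (0 < d)%R /\ forall y, (Rabs (y - x) < d)%R ->
    (Rabs (f y - f x - (y - x) * l) <= eps * Rabs (y - x))%R.
Proof.
  intros [_ H] eps Heps.
  specialize (H x (fun P HP => HP) (mkposreal eps Heps)).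
  destruct (proj1 (locally_R x _) H) as (d & Hd & Hd'). exists d. now split.
Qed.

Lemma Im_le_Cmod (z : C) : (Rabs (Im z) <= Cmod z)%R.
Proof. eapply Rle_trans; [apply Rmax_r|apply Rmax_Cmod]. Qed.

Lemma cexp_derive_0 : Cis_derive cexp 0 1.
Proof.
  apply Cis_derive_eps. intros eps Heps.
  (* The error splits into three terms bounded by 4 eta |h|, eta |h| and eta |h|. The radius eta / 2
     used below gives |exp x - 1| <= eta, and eta <= 1 gives exp x <= 2. *)
  set (eta := Rmin 1 (eps / 6)).
  assert (Heta : (0 < eta)%R) by (apply Rmin_pos; lra).
  assert (He1 : (eta <= 1)%R) by apply Rmin_l.
  assert (He2 : (eta <= eps / 6)%R) by apply Rmin_r.
  assert (De : is_derive exp 0 1) by (auto_derive; [easy|rewrite exp_0; ring]).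
  assert (Dc : is_derive cos 0 0) by (auto_derive; [easy|rewrite sin_0; ring]).
  assert (Ds : is_derive sin 0 1) by (auto_derive; [easy|rewrite cos_0; ring]).
  destruct (is_derive_eps _ _ _ De eta Heta) as (d1 & Hd1 & B1).
  destruct (is_derive_eps _ _ _ Dc eta Heta) as (d2 & Hd2 & B2).
  destruct (is_derive_eps _ _ _ Ds eta Heta) as (d3 & Hd3 & B3).
  exists (Rmin (eta / 2) (Rmin d1 (Rmin d2 d3))).
  split; [repeat apply Rmin_pos; lra|].
  intros h Hh. replace (h - 0) with h in * by ring.
  apply Rmin_Rgt_l in Hh. destruct Hh as [Hh0 Hh].
  apply Rmin_Rgt_l in Hh. destruct Hh as [Hh1 Hh].
  apply Rmin_Rgt_l in Hh. destruct Hh as [Hh2 Hh3].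
  pose proof (re_le_Cmod h) as Hx. pose proof (Im_le_Cmod h) as Hy.
  set (x := Re h) in *. set (y := Im h) in *.
  specialize (B1 x). specialize (B2 y). specialize (B3 y).
  rewrite exp_0 in B1. rewrite cos_0 in B2. rewrite sin_0 in B3.
  rewrite !Rminus_0_r in *.
  specialize (B1 ltac:(lra)). specialize (B2 ltac:(lra)). specialize (B3 ltac:(lra)).
  rewrite Rmult_1_r in B1, B3. rewrite Rmult_0_r, Rminus_0_r in B2.
  assert (Hex : (Rabs (exp x - 1) <= eta)%R).
  { replace (exp x - 1)%R with ((exp x - 1 - x) + x)%R by ring.
    eapply Rle_trans; [apply Rabs_triang|]. pose proof (Rabs_pos x). nra. }
  assert (Hex2 : (exp x <= 2)%R) by (apply Rabs_le_between in Hex; lra).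
  pose proof (exp_pos x) as Hex0.
  rewrite cexp_0. unfold cexp. fold x y.
  replace (RtoC (exp x) * cis y - 1 - 1 * h) with
    (RtoC (exp x) * (RtoC (cos y - 1) + Ci * RtoC (sin y - y))
      + (RtoC (exp x - 1 - x) + Ci * RtoC y * RtoC (exp x - 1))).
  2:{ rewrite (surjective_pairing h). change (fst h) with x. change (snd h) with y.
      unfold cis. apply injective_projections; simpl; ring. }
  eapply Rle_trans; [apply Cmod_triangle|].
  eapply Rle_trans; [apply Rplus_le_compat_l, Cmod_triangle|].
  rewrite !Cmod_mult, !Cmod_R, Cmod_Ci, (Rabs_pos_eq (exp x)) by lra.
  assert (H1 : (Cmod (RtoC (cos y - 1) + Ci * RtoC (sin y - y)) <= 2 * eta * Cmod h)%R).
  { eapply Rle_trans; [apply Cmod_triangle|]. rewrite Cmod_mult, !Cmod_R, Cmod_Ci. nra. }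
  pose proof (Cmod_ge_0 (RtoC (cos y - 1) + Ci * RtoC (sin y - y))) as H2.
  pose proof (Cmod_ge_0 h) as H3. pose proof (Rabs_pos x). pose proof (Rabs_pos y).
  pose proof (Rabs_pos (exp x - 1)).
  assert (exp x * Cmod (RtoC (cos y - 1) + Ci * RtoC (sin y - y)) <= 2 * (2 * eta * Cmod h))%R
    by (apply Rmult_le_compat; lra).
  assert (Rabs (exp x - 1 - x) <= eta * Cmod h)%R by nra.
  assert (1 * Rabs y * Rabs (exp x - 1) <= 1 * Cmod h * eta)%R
    by (apply Rmult_le_compat; lra).
  assert (eta * Cmod h <= eps / 6 * Cmod h)%R by (apply Rmult_le_compat_r; lra).
  lra.
Qed.

Lemma cexp_derive (z : C) : Cis_derive cexp z (cexp z).
Proof.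
  apply Cis_derive_ext with (fun y => cexp z * cexp (y - z)).
  { intros y. rewrite <- cexp_plus. f_equal. ring. }
  enough (H : Cis_derive (fun y => cexp z * cexp (y - z)) z (cexp z * (1 * (1 - 0)))).
  { now replace (cexp z * (1 * (1 - 0))) with (cexp z) in H by ring. }
  apply Cis_derive_scal. apply (Cis_derive_comp cexp (fun y => y - z)).
  - replace (z - z) with (RtoC 0) by ring. apply cexp_derive_0.
  - apply Cis_derive_minus; [apply Cis_derive_id|apply Cis_derive_const].
Qed.

(** If p is the slope of h at g w, then y - w = p(g y) (g y - g w); division by p(g y), nonzero near
    w, exhibits 1 / p(g y) as the slope of g. *)
Lemma Cis_derive_right_inverse (g h : C -> C) (w l : C) :
  locally (T := CU) w (fun y => h (g y) = y) -> ccont (T := CU) g w ->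
  Cis_derive h (g w) l -> l <> 0 -> Cis_derive g w (/ l).
Proof.
  intros Hinv Hg Hh Hl. apply Cis_derive_slope in Hh. destruct Hh as (p & Hp & <- & E).
  assert (Hc : ccont (T := CU) (fun y => p (g y)) w).
  { apply (ccont_comp (T := CU) p g); assumption. }
  pose proof (locally_singleton _ _ Hinv) as Hw. simpl in Hw.
  apply Cis_derive_ext_loc with (fun y => g w + / p (g y) * (y - w)).
  - generalize (filter_and _ _ Hinv (ccont_neq_0 (T := CU) _ _ Hc Hl)).
    apply filter_imp. intros y [Hy Hn].
    rewrite <- Hy at 2. rewrite (E (g y)), Hw. field. exact Hn.
  - apply Cis_derive_slope. exists (fun y => / p (g y)).
    split; [now apply (ccont_inv (T := CU))|]. split; [easy|]. intros y. ring.
Qed.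

(** The principal logarithm on the right half-plane, where the arctangent is the argument; its
    properties are stated for Re w > 0. *)
Definition Clog (w : C) : C := (ln (Cmod w), atan (Im w / Re w)).

Lemma cexp_Clog (w : C) : (0 < Re w)%R -> cexp (Clog w) = w.
Proof.
  intros Hw. assert (Hm : (0 < Cmod w)%R).
  { eapply Rlt_le_trans; [exact Hw|]. eapply Rle_trans; [apply Rle_abs|apply re_le_Cmod]. }
  set (x := Re w) in *. set (y := Im w).
  assert (Hs : Cmod w = (x * sqrt (1 + Rsqr (y / x)))%R).
  { rewrite <- (sqrt_pow2 x) at 1 by lra. rewrite <- sqrt_mult_alt by apply pow2_ge_0.
    unfold Cmod. f_equal. unfold Rsqr, x, y, Re, Im. field.
    unfold x, Re in Hw. lra. }
  assert (Hq : (0 < sqrt (1 + Rsqr (y / x)))%R).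
  { apply sqrt_lt_R0. pose proof (Rle_0_sqr (y / x)). lra. }
  unfold cexp, Clog, cis. simpl. fold x y. rewrite exp_ln, cos_atan, sin_atan by assumption.
  rewrite Hs, (surjective_pairing w). change (fst w) with x. change (snd w) with y.
  apply injective_projections; simpl; field; lra.
Qed.

Lemma Clog_1 : Clog 1 = 0.
Proof.
  unfold Clog. rewrite Cmod_1, ln_1. simpl.
  replace (0 / 1)%R with 0%R by field. now rewrite atan_0.
Qed.

Lemma continuous_Re_CU (z : C) : continuous (T := CU) Re z.
Proof. apply (proj1 (ccont_Re_Im (T := CU) _ _ (ccont_id z))). Qed.

Lemma continuous_Im_CU (z : C) : continuous (T := CU) Im z.
Proof. apply (proj2 (ccont_Re_Im (T := CU) _ _ (ccont_id z))). Qed.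

Lemma continuous_Cmod_CU (z : C) : continuous (T := CU) Cmod z.
Proof.
  apply filterlim_locally. intros eps. apply locally_CU.
  exists eps. split; [apply cond_pos|]. intros y Hy.
  change (Rabs (Cmod y - Cmod z) < eps)%R.
  pose proof (Cmod_triangle_inv y z). pose proof (Cmod_triangle_inv z y) as H1.
  replace (z - y) with (- (y - z)) in H1 by ring. rewrite Cmod_opp in H1.
  apply Rabs_def1; lra.
Qed.

Lemma ccont_Clog (w : C) : (0 < Re w)%R -> ccont (T := CU) Clog w.
Proof.
  intros Hw. assert (Hm : (0 < Cmod w)%R).
  { eapply Rlt_le_trans; [exact Hw|]. eapply Rle_trans; [apply Rle_abs|apply re_le_Cmod]. }
  apply (ccont_pair (T := CU)).
  - apply (continuous_comp (U := CU) Cmod ln); [apply continuous_Cmod_CU|].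
    apply (ex_derive_continuous (V := R_NormedModule)). now auto_derive.
  - apply (continuous_comp (U := CU) (fun w => Im w / Re w)%R atan).
    + apply (continuous_mult (U := CU) (K := R_AbsRing) Im (fun w => / Re w)%R);
        [apply continuous_Im_CU|].
      apply (continuous_comp (U := CU) Re Rinv); [apply continuous_Re_CU|].
      apply (ex_derive_continuous (V := R_NormedModule)). auto_derive. lra.
    + apply (ex_derive_continuous (V := R_NormedModule)). now auto_derive.
Qed.

Lemma Clog_derive (w : C) : (0 < Re w)%R -> Cis_derive Clog w (/ w).
Proof.
  intros Hw. rewrite <- (cexp_Clog w Hw) at 2.
  apply Cis_derive_right_inverse with cexp.
  - apply locally_CU. exists (Re w). split; [exact Hw|]. intros y Hy. apply cexp_Clog.
    pose proof (re_le_Cmod (y - w)) as H. apply Rabs_le_between in H.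
    unfold Re in *. simpl in H. lra.
  - now apply ccont_Clog.
  - apply cexp_derive.
  - apply cexp_neq_0.
Qed.

Definition csqrt (w : C) : C := cexp (/ 2 * Clog w).

Lemma csqrt_sqr (w : C) : (0 < Re w)%R -> csqrt w * csqrt w = w.
Proof.
  intros Hw. unfold csqrt. rewrite <- cexp_plus.
  replace (/ 2 * Clog w + / 2 * Clog w) with (Clog w) by field. now apply cexp_Clog.
Qed.

(** The argument of [csqrt w] is half an arctangent, so its cosine is positive. This yields |csqrt w
    + 1| >= 1 in [subord_phi_car]. *)
Lemma csqrt_Re (w : C) : (0 < Re (csqrt w))%R.
Proof.
  set (c := / 2 * Clog w).
  assert (Hc : Im c = (atan (Im w / Re w) / 2)%R).
  { unfold c. simpl. field. }
  replace (Re (csqrt w)) with (exp (Re c) * cos (Im c))%R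
    by (unfold csqrt, cexp; fold c; simpl; ring).
  apply Rmult_lt_0_compat; [apply exp_pos|]. rewrite Hc.
  pose proof (atan_bound (Im w / Re w)).
  apply cos_gt_0; pose proof PI_RGT_0; lra.
Qed.

Lemma csqrt_1 : csqrt 1 = 1.
Proof. unfold csqrt. rewrite Clog_1, Cmult_0_r. apply cexp_0. Qed.

Lemma ex_csqrt_derive (f : C -> C) (z : C) :
  (exists l, Cis_derive f z l) -> (0 < Re (f z))%R ->
  exists l, Cis_derive (fun y => csqrt (f y)) z l.
Proof.
  intros [l Hl] Hz. eexists.
  apply (Cis_derive_comp cexp (fun y => / 2 * Clog (f y))); [apply cexp_derive|].
  apply Cis_derive_scal. apply (Cis_derive_comp Clog f); [now apply Clog_derive|exact Hl].
Qed.

(** * Subordination to [phi_car] *)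

Lemma inD_0 : inD 0.
Proof. unfold inD. rewrite Cmod_0. lra. Qed.

Lemma subord_phi_car (s F : C -> C) :
  analytic_D s -> s 0 = 0 -> (forall z, inD z -> (Cmod (s z) < 1)%R) ->
  (forall z, inD z -> F z = 1 + s z / 2) -> subord F phi_car.
Proof.
  intros Hs Hs0 Hb HF.
  assert (HRe : forall z, inD z -> (0 < Re (1 + s z))%R).
  { intros z Hz. specialize (Hb z Hz). pose proof (re_le_Cmod (s z)) as H.
    apply Rabs_le_between in H. unfold Re in *. simpl. lra. }
  exists (fun z => csqrt (1 + s z) - 1). split; [|split; [|split]].
  - intros z Hz. destruct (analytic_D_derive s z Hs Hz) as [l Hl].
    destruct (ex_csqrt_derive (fun y => 1 + s y) z) as [m Hm]; [|now apply HRe|].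
    + eexists. apply Cis_derive_plus; [apply Cis_derive_const|exact Hl].
    + eexists. apply (Cis_derive_minus (fun y => csqrt (1 + s y)) (fun _ => 1));
        [exact Hm|apply Cis_derive_const].
  - intros z Hz. specialize (HRe z Hz). specialize (Hb z Hz). unfold inD.
    set (c := csqrt (1 + s z)).
    assert (Hc : (c - 1) * (c + 1) = s z).
    { transitivity (c * c - 1); [ring|]. unfold c. rewrite csqrt_sqr by assumption. ring. }
    assert (Hc1 : (1 <= Cmod (c + 1))%R).
    { eapply Rle_trans; [|apply re_le_Cmod]. eapply Rle_trans; [|apply Rle_abs].
      assert (H : (0 < Re c)%R) by apply csqrt_Re.
      replace (Re (c + 1)) with (Re c + 1)%R by reflexivity. lra. }
    apply (f_equal Cmod) in Hc. rewrite Cmod_mult in Hc.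
    pose proof (Cmod_ge_0 (c - 1)). nra.
  - rewrite Hs0, Cplus_0_r, csqrt_1. ring.
  - intros z Hz. rewrite (HF z Hz). unfold phi_car.
    set (c := csqrt (1 + s z)).
    assert (Hc : c * c = 1 + s z) by (apply csqrt_sqr, HRe, Hz).
    replace (s z) with (c * c - 1) by (rewrite Hc; ring).
    field.
Qed.

Lemma inD_scale (r : R) (z : C) : (0 < r <= 1)%R -> inD z ->
  inD (RtoC r * z) /\ (Cmod (RtoC r * z) < r)%R.
Proof.
  unfold inD. intros Hr Hz. rewrite Cmod_mult, Cmod_R, Rabs_pos_eq by lra.
  pose proof (Cmod_ge_0 z). split; nra.
Qed.

(** * Radii *)

Section Dilation.
Variables (f : C -> C) (r : R).
Hypotheses (Hf : classA f) (Hr : (0 < r <= 1)%R).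

Let r_neq : RtoC r <> 0.
Proof. intros E. apply RtoC_inj in E. lra. Qed.

Let dil_derive (z l : C) : Cis_derive f (RtoC r * z) l ->
  Cis_derive (fun z => f (RtoC r * z) / RtoC r) z l.
Proof.
  intros H.
  replace l with (/ RtoC r * (l * (RtoC r * 1))) by (field; exact r_neq).
  apply Cis_derive_ext with (fun z => / RtoC r * f (RtoC r * z)); [intros y; apply Cmult_comm|].
  apply Cis_derive_scal. apply (Cis_derive_comp f (fun z => RtoC r * z)); [exact H|].
  apply Cis_derive_scal, Cis_derive_id.
Qed.

Lemma classA_dilation : classA (fun z => f (RtoC r * z) / RtoC r).
Proof.
  destruct Hf as (H1 & H2 & H3). split; [|split].
  - intros z Hz. destruct (analytic_D_derive f (RtoC r * z) H1) as [l Hl].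
    + now apply inD_scale.
    + exists l. now apply dil_derive.
  - rewrite Cmult_0_r, H2. field. exact r_neq.
  - apply dil_derive. now rewrite Cmult_0_r.
Qed.

Lemma zfpf_dilation (z : C) : inD z ->
  zfpf (fun z => f (RtoC r * z) / RtoC r) z = zfpf f (RtoC r * z).
Proof.
  intros Hz. destruct Hf as (H1 & _).
  destruct (analytic_D_derive f (RtoC r * z) H1) as [l Hl]; [now apply inD_scale|].
  unfold zfpf. destruct (Ceq_dec z 0) as [->|Hz0].
  - rewrite Cmult_0_r. now destruct (Ceq_dec 0 0).
  - destruct (Ceq_dec (RtoC r * z) 0) as [E|_].
    { exfalso. revert E. now apply Cmult_neq_0. }
    rewrite (Cderiv_unique _ _ _ (dil_derive z l Hl)), (Cderiv_unique _ _ _ Hl).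
    (* Membership in [classA] does not exclude further zeros of f; at such a point both quotients
       are 0 by the convention / 0 = 0. *)
    destruct (Ceq_dec (f (RtoC r * z)) 0) as [E|Hn].
    + assert (E0 : / 0 = 0) by (apply injective_projections; simpl; unfold Rdiv; ring).
      rewrite E. unfold Cdiv. now rewrite Cmult_0_l, E0, !Cmult_0_r.
    + field. now split.
Qed.

Lemma S_car_dilation (s : C -> C) :
  analytic_D s -> s 0 = 0 -> (forall z, inD z -> (Cmod (s z) < 1)%R) ->
  (forall z, inD z -> zfpf f (RtoC r * z) = 1 + s z / 2) ->
  S_car (fun z => f (RtoC r * z) / RtoC r).
Proof.
  intros Hs Hs0 Hb E. split; [apply classA_dilation|].
  apply (subord_phi_car s); try assumption.
  intros z Hz. rewrite zfpf_dilation by assumption. now apply E.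
Qed.

End Dilation.

Lemma analytic_D_comp (f g : C -> C) :
  analytic_D f -> analytic_D g -> (forall z, inD z -> inD (g z)) ->
  analytic_D (fun z => f (g z)).
Proof.
  intros Hf Hg HD z Hz.
  destruct (analytic_D_derive g z Hg Hz) as [m Hm].
  destruct (analytic_D_derive f (g z) Hf (HD z Hz)) as [l Hl].
  exists (l * m). now apply Cis_derive_comp.
Qed.

Lemma analytic_D_scale (r : R) : analytic_D (fun z => RtoC r * z).
Proof. intros z _. eexists. apply Cis_derive_scal, Cis_derive_id. Qed.

Lemma locally_Cmod_lt (z : C) (r : R) :
  (Cmod z < r)%R -> locally (T := CU) z (fun y => (Cmod y < r)%R).
Proof.
  intros Hz. apply locally_CU. exists (r - Cmod z)%R. split; [lra|].
  intros y Hy. pose proof (Cmod_triangle_inv y z). lra.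
Qed.

(* Writing [f z = z q z] gives [zfpf f = 1 + z q' / q], also at the removable point. *)
Lemma analytic_zfpf (f : C -> C) :
  classA f -> (forall z, inD z -> z <> 0 -> f z <> 0) -> analytic_D (zfpf f).
Proof.
  intros (Hf & Hf0 & Hf1) Hnz z Hz. unfold inD in *. pose proof (Cmod_ge_0 z).
  set (rad := ((Cmod z + 1) / 2)%R).
  destruct (analytic_factor f rad Hf Hf0 ltac:(unfold rad; lra)) as (q & q' & q'' & Hq).
  assert (Hrad : (Cmod z < rad < 1)%R) by (unfold rad; lra).
  assert (Hder : forall y, (Cmod y < rad)%R -> Cis_derive f y (q y + y * q' y)).
  { intros y Hy. apply Cis_derive_ext_loc with (fun y => y * q y).
    - generalize (locally_Cmod_lt y rad Hy). apply filter_imp. intros x Hx.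
      symmetry. now apply Hq.
    - replace (q y + y * q' y) with (1 * q y + y * q' y) by ring.
      apply Cis_derive_mult; [apply Cis_derive_id|now apply Hq]. }
  (* At 0 the value of q is f'(0) = 1; elsewhere a zero of q would be a zero of f. *)
  assert (Hqnz : forall y, (Cmod y < rad)%R -> q y <> 0).
  { intros y Hy E. destruct (Ceq_dec y 0) as [->|Hy0].
    - pose proof (Cderiv_unique _ _ _ Hf1) as E1.
      rewrite (Cderiv_unique _ _ _ (Hder 0 Hy)), E in E1.
      apply (f_equal Re) in E1. simpl in E1. lra.
    - apply (Hnz y); [lra|assumption|]. rewrite (proj1 (Hq y Hy)), E. ring. }
  assert (HF : forall y, (Cmod y < rad)%R -> 1 + y * q' y / q y = zfpf f y).
  { intros y Hy. pose proof (Hqnz y Hy). unfold zfpf. destruct (Ceq_dec y 0) as [->|Hy0].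
    - field. assumption.
    - rewrite (Cderiv_unique _ _ _ (Hder y Hy)), (proj1 (Hq y Hy)). field. now split. }
  eexists. apply Cis_derive_ext_loc with (fun y => 1 + y * q' y / q y).
  - generalize (locally_Cmod_lt z rad (proj1 Hrad)). apply filter_imp. exact HF.
  - apply Cis_derive_plus; [apply Cis_derive_const|].
    apply (Cis_derive_div (fun y => y * q' y) q); [now apply Hqnz| |now apply Hq].
    apply Cis_derive_mult; [apply Cis_derive_id|now apply Hq].
Qed.

(** The equation characterises 1 / (1 + sqrt (1 + alpha)) without dividing by alpha, so alpha = 0
    needs no separate case. It gives |1 - alpha u^2| >= 1 - alpha rho^2 = 2 rho > 2 |u| whenever |u|
    < rho, so s = 2 u / (1 - alpha u^2) has modulus below 1. *)
Lemma BL_radius_member (alpha rho : R) : (0 <= alpha)%R -> (0 < rho <= 1)%R ->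
  (alpha * rho ^ 2 + 2 * rho = 1)%R -> Scar_radius_set (BL alpha) rho.
Proof.
  intros Ha Hrho Heq. split; [assumption|]. intros f [Hf (w & Hw & HwD & Hw0 & HF)].
  assert (Hu : forall z, inD z -> (Cmod (w (RtoC rho * z)%C) < rho)%R).
  { intros z Hz. destruct (inD_scale rho z Hrho Hz) as [H1 H2].
    pose proof (Schwarz_disc w _ Hw HwD Hw0 H1). lra. }
  set (u := fun z => w (RtoC rho * z)).
  set (d := fun z => 1 - RtoC alpha * (u z * u z)).
  assert (Hd : forall z, inD z -> (2 * Cmod (u z) < Cmod (d z))%R).
  { intros z Hz. pose proof (Hu z Hz) as H. fold (u z) in H. pose proof (Cmod_ge_0 (u z)).
    pose proof (Cmod_triangle_inv 1 (RtoC alpha * (u z * u z))) as H1.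
    rewrite Cmod_1, !Cmod_mult, Cmod_R, Rabs_pos_eq in H1 by assumption. fold (d z) in H1.
    assert (alpha * (Cmod (u z) * Cmod (u z)) <= alpha * (rho * rho))%R.
    { apply Rmult_le_compat_l; [assumption|]. apply Rmult_le_compat; lra. }
    lra. }
  assert (Hdnz : forall z, inD z -> d z <> 0).
  { intros z Hz. apply Cmod_gt_0. pose proof (Hd z Hz). pose proof (Cmod_ge_0 (u z)). lra. }
  assert (Hua : analytic_D u).
  { apply (analytic_D_comp w (fun z => RtoC rho * z)); [assumption|apply analytic_D_scale|].
    intros z Hz. now apply inD_scale. }
  apply (S_car_dilation f rho Hf Hrho (fun z => 2 * u z / d z)).
  - intros z Hz. destruct (analytic_D_derive u z Hua Hz) as [l Hl].
    eexists. apply (Cis_derive_div (fun z => 2 * u z) d); [now apply Hdnz| |].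
    + apply Cis_derive_scal. exact Hl.
    + apply Cis_derive_minus; [apply Cis_derive_const|].
      apply Cis_derive_scal, Cis_derive_mult; exact Hl.
  - unfold u. rewrite Cmult_0_r, Hw0. unfold Cdiv. ring.
  - intros z Hz. pose proof (Hd z Hz). pose proof (Cmod_ge_0 (u z)).
    rewrite Cmod_div, Cmod_mult, Cmod_R, Rabs_pos_eq by (try apply Hdnz; assumption || lra).
    apply Rlt_div_l; lra.
  - intros z Hz. rewrite HF by now apply inD_scale. fold (u z). fold (d z).
    field. now apply Hdnz.
Qed.

Lemma M_radius_member (beta : R) : (1 < beta)%R ->
  Scar_radius_set (M_class beta) (1 / (4 * beta - 3)).
Proof.
  intros Hb. set (rho := (1 / (4 * beta - 3))%R).
  assert (Hrho : (0 < rho <= 1)%R).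
  { split; [apply Rdiv_lt_0_compat; lra|]. apply Rle_div_l; lra. }
  split; [assumption|]. intros f (Hf & Hnz & HRe).
  pose proof (analytic_zfpf f Hf Hnz) as HFa. set (F := zfpf f) in *.
  assert (HF0 : F 0 = 1) by (unfold F, zfpf; now destruct (Ceq_dec 0 0)).
  (* c is the mirror image of 1 in the line Re = beta: |F - c|^2 - |F - 1|^2 = 4 (beta - 1) (beta -
     Re F). Hence p below maps the disc to itself and vanishes at 0. *)
  set (c := RtoC (2 * beta - 1)).
  assert (Hden : forall z, inD z -> (Cmod (F z - 1) < Cmod (F z - c))%R).
  { intros z Hz. specialize (HRe z Hz). unfold Cmod. apply sqrt_lt_1_alt.
    unfold c. destruct (F z) as [x y]. simpl in *.
    assert (0 < (beta - 1) * (beta - x))%R by (apply Rmult_lt_0_compat; lra).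
    pose proof (pow2_ge_0 (x - 1)). pose proof (pow2_ge_0 y). split; lra. }
  assert (Hnc : forall z, inD z -> F z - c <> 0).
  { intros z Hz. apply Cmod_gt_0. pose proof (Hden z Hz). pose proof (Cmod_ge_0 (F z - 1)). lra. }
  set (p := fun z => (F z - 1) / (F z - c)).
  assert (Hp : analytic_D p).
  { intros z Hz. destruct (analytic_D_derive F z HFa Hz) as [l Hl].
    eexists. apply (Cis_derive_div (fun z => F z - 1) (fun z => F z - c)); [now apply Hnc| |];
      (apply Cis_derive_minus; [exact Hl|apply Cis_derive_const]). }
  assert (HpE : forall z, inD z -> (Cmod (F z - 1) = Cmod (p z) * Cmod (F z - c))%R).
  { intros z Hz. rewrite <- Cmod_mult. f_equal. unfold p. field. now apply Hnc. }
  assert (HpD : forall z, inD z -> inD (p z)).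
  { intros z Hz. unfold inD, p. rewrite Cmod_div by now apply Hnc.
    pose proof (Hden z Hz). pose proof (Cmod_ge_0 (F z - 1)). apply Rlt_div_l; lra. }
  assert (Hp0 : p 0 = 0) by (unfold p; rewrite HF0; unfold Cdiv; ring).
  apply (S_car_dilation f rho Hf Hrho (fun z => 2 * (F (RtoC rho * z) - 1))).
  - intros z Hz.
    assert (HFr : analytic_D (fun z => F (RtoC rho * z))).
    { apply (analytic_D_comp F (fun z => RtoC rho * z)); [assumption|apply analytic_D_scale|].
      intros y Hy. now apply inD_scale. }
    destruct (analytic_D_derive _ z HFr Hz) as [l Hl].
    eexists. apply Cis_derive_scal.
    apply Cis_derive_minus; [exact Hl|apply Cis_derive_const].
  - rewrite Cmult_0_r, HF0. ring.
  - intros z Hz. destruct (inD_scale rho z Hrho Hz) as [HD HC].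
    set (x := RtoC rho * z) in *.
    pose proof (Schwarz_disc p x Hp HpD Hp0 HD) as HS. pose proof (HpE x HD) as E.
    assert (HT : (Cmod (F x - c) <= Cmod (F x - 1) + (2 * beta - 2))%R).
    { replace (F x - c) with ((F x - 1) + RtoC (2 - 2 * beta))
        by (unfold c; rewrite !RtoC_minus; ring).
      eapply Rle_trans; [apply Cmod_triangle|]. rewrite Cmod_R, Rabs_left by lra. lra. }
    assert (HP : (Cmod (p x) * (4 * beta - 3) < 1)%R).
    { apply Rlt_div_r; [lra|]. fold rho. lra. }
    pose proof (Cmod_ge_0 (p x)). pose proof (Cmod_ge_0 (F x - 1)).
    rewrite Cmod_mult, Cmod_R, Rabs_pos_eq by lra.
    (* Put A = |F x - 1| and P = |p x|. If A >= 1/2, then 2 beta - 2 <= (4 beta - 4) A, so A <= P (A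
       + 2 beta - 2) <= P (4 beta - 3) A < A. *)
    apply Rnot_le_lt. intros Hge. nra.
  - intros z Hz. fold F. field.
Qed.

(** * Sharpness of the radii *)

(** For w = p + i q the imaginary part of [phi_car w] is q (1 + p) with 1 + p > 0. A real value thus
    forces q = 0 and equals ((1 + p)^2 + 1) / 2. *)
Lemma phi_car_real (w : C) (v : R) : inD w -> phi_car w = RtoC v -> (/ 2 < v)%R.
Proof.
  unfold inD, phi_car. intros Hw E. pose proof (re_le_Cmod w) as H.
  apply Rabs_le_between in H. destruct w as [p q]. unfold Re in H. simpl in H.
  pose proof (f_equal Re E) as E1. pose proof (f_equal Im E) as E2.
  simpl in E1, E2. field_simplify in E1. field_simplify in E2.
  assert (Hq : q = 0%R).
  { assert (q * (1 + p) = 0)%R by lra. nra. }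
  subst q. nra.
Qed.

(** A member r > rho would make the dilation by r subordinate to [phi_car]; its quotient at sgn x /
    r is the one of f at sgn x, a forbidden real value once rho < x < r. The sign selects the
    half-axis: negative for [BL], positive for [M_class]. *)
Lemma radius_upper (F : (C -> C) -> Prop) (f : C -> C) (v : R -> R) (sgn rho : R) :
  F f -> classA f -> Rabs sgn = 1%R -> (0 < rho)%R ->
  (forall x, (rho < x < 1)%R -> zfpf f (RtoC (sgn * x)) = RtoC (v x) /\ (v x <= / 2)%R) ->
  is_upper_bound (Scar_radius_set F) rho.
Proof.
  intros HF Hf Hsgn Hrho Hv r [Hr HS].
  destruct (Rle_or_lt r rho) as [|Hlt]; [assumption|exfalso].
  destruct (HS f HF) as [_ (w & _ & HwD & _ & HE)].
  set (x := ((rho + r) / 2)%R).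
  assert (Hx : (rho < x < r)%R) by (unfold x; lra).
  assert (Hz : inD (RtoC (sgn * x / r))).
  { unfold inD. rewrite Cmod_R. unfold Rdiv. rewrite !Rabs_mult, Hsgn, Rabs_inv, !Rabs_pos_eq by lra.
    apply Rlt_div_l; lra. }
  specialize (HE _ Hz). rewrite zfpf_dilation in HE by assumption.
  rewrite <- RtoC_mult in HE. replace (r * (sgn * x / r))%R with (sgn * x)%R in HE by (field; lra).
  destruct (Hv x ltac:(lra)) as [E Hle]. rewrite E in HE. symmetry in HE.
  apply phi_car_real in HE; [lra|now apply HwD].
Qed.

Section Extremal.
Variables E e : C -> C.
Hypotheses (HE : forall z, inD z -> Cis_derive E z (e z)) (HE0 : E 0 = 0).

Let f (z : C) : C := z * cexp (E z).

Let f_derive (z : C) : inD z -> Cis_derive f z (cexp (E z) * (1 + z * e z)).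
Proof.
  intros Hz.
  replace (cexp (E z) * (1 + z * e z)) with (1 * cexp (E z) + z * (cexp (E z) * e z)) by ring.
  apply (Cis_derive_mult (fun z => z) (fun z => cexp (E z))); [apply Cis_derive_id|].
  apply (Cis_derive_comp cexp E); [apply cexp_derive|now apply HE].
Qed.

Lemma extremal_classA : classA f.
Proof.
  split; [|split].
  - intros z Hz. eexists. now apply f_derive.
  - unfold f. ring.
  - replace (RtoC 1) with (cexp (E 0) * (1 + 0 * e 0)).
    + apply f_derive, inD_0.
    + rewrite HE0, cexp_0. ring.
Qed.

Lemma extremal_neq_0 (z : C) : z <> 0 -> f z <> 0.
Proof. intros Hz. apply Cmult_neq_0; [assumption|apply cexp_neq_0]. Qed.

Lemma extremal_zfpf (z : C) : inD z -> zfpf f z = 1 + z * e z.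
Proof.
  intros Hz. unfold zfpf. destruct (Ceq_dec z 0) as [->|Hz0]; [ring|].
  rewrite (Cderiv_unique _ _ _ (f_derive z Hz)). unfold f. field.
  split; [apply cexp_neq_0|assumption].
Qed.

End Extremal.

Lemma Re_1_minus_pos (z : C) : (Cmod z < 1)%R -> (0 < Re (1 - z))%R.
Proof.
  intros Hz. pose proof (re_le_Cmod z) as H. apply Rabs_le_between in H.
  unfold Re in *. simpl. lra.
Qed.

Lemma Clog_1_minus_derive (c z : C) : (Cmod (c * z) < 1)%R ->
  1 - c * z <> 0 /\ Cis_derive (fun z => Clog (1 - c * z)) z (/ (1 - c * z) * - c).
Proof.
  intros Hz. pose proof (Re_1_minus_pos _ Hz) as HRe. split.
  - intros H. rewrite H in HRe. simpl in HRe. lra.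
  - replace (- c) with (0 - c * 1) by ring.
    apply (Cis_derive_comp Clog (fun z => 1 - c * z)); [now apply Clog_derive|].
    apply Cis_derive_minus; [apply Cis_derive_const|].
    apply Cis_derive_scal, Cis_derive_id.
Qed.

(** With a = sqrt alpha the primitive is artanh(a z) / a, written through log (1 + a z) and log (1 -
    a z); it degenerates to z at alpha = 0. The form [1 - - RtoC a * z] matches
    [Clog_1_minus_derive] with c = -a. *)
Lemma BL_primitive (alpha : R) : (0 <= alpha < 1)%R -> exists E : C -> C, E 0 = 0 /\
  forall z, inD z -> Cis_derive E z (/ (1 - RtoC alpha * (z * z))).
Proof.
  intros Ha. destruct (Req_dec alpha 0) as [->|Hn].
  - exists (fun z => z). split; [reflexivity|]. intros z _.
    replace (/ (1 - RtoC 0 * (z * z))) with (RtoC 1) by field. apply Cis_derive_id.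
  - set (a := sqrt alpha).
    assert (Haa : (a * a = alpha)%R) by (apply sqrt_sqrt; lra).
    assert (Ha0 : (0 < a)%R) by (apply sqrt_lt_R0; lra).
    assert (Ha1 : (a < 1)%R) by nra.
    assert (Hanz : RtoC a <> 0) by (intros H; apply RtoC_inj in H; lra).
    exists (fun z => / (2 * RtoC a) * (Clog (1 - - RtoC a * z) - Clog (1 - RtoC a * z))).
    split.
    + replace (1 - - RtoC a * 0) with (RtoC 1) by ring.
      replace (1 - RtoC a * 0) with (RtoC 1) by ring. ring.
    + intros z Hz. unfold inD in Hz. pose proof (Cmod_ge_0 z).
      destruct (Clog_1_minus_derive (- RtoC a) z) as [N1 D1].
      { rewrite Cmod_mult, Cmod_opp, Cmod_R, Rabs_pos_eq by lra. nra. }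
      destruct (Clog_1_minus_derive (RtoC a) z) as [N2 D2].
      { rewrite Cmod_mult, Cmod_R, Rabs_pos_eq by lra. nra. }
      replace (/ (1 - RtoC alpha * (z * z))) with
        (/ (2 * RtoC a) * (/ (1 - - RtoC a * z) * - - RtoC a - / (1 - RtoC a * z) * - RtoC a)).
      * apply Cis_derive_scal. apply Cis_derive_minus; assumption.
      * rewrite <- Haa, RtoC_mult.
        replace (1 - RtoC a * RtoC a * (z * z)) with ((1 - - RtoC a * z) * (1 - RtoC a * z))
          by ring.
        field. repeat split; assumption.
Qed.

Lemma BL_radius_upper (alpha rho : R) : (0 <= alpha < 1)%R -> (0 < rho)%R ->
  (alpha * rho ^ 2 + 2 * rho = 1)%R -> is_upper_bound (Scar_radius_set (BL alpha)) rho.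
Proof.
  intros Ha Hrho Heq. destruct (BL_primitive alpha Ha) as (E & HE0 & HE).
  pose proof (extremal_classA _ _ HE HE0) as HA.
  pose proof (extremal_zfpf _ _ HE) as HZ.
  apply (radius_upper _ (fun z => z * cexp (E z))
    (fun x => 1 - x / (1 - alpha * x ^ 2))%R (-1) rho); [|assumption| |assumption|].
  - split; [assumption|]. exists (fun z => z). split; [|split; [|split]]; try easy.
    intros z _. eexists. apply Cis_derive_id.
  - rewrite Rabs_left; lra.
  - intros x Hx. assert (Hax : (0 < 1 - alpha * x ^ 2)%R) by nra.
    split.
    + rewrite HZ.
      2:{ unfold inD. rewrite Cmod_R, Rabs_left; lra. }
      rewrite RtoC_minus, RtoC_div, RtoC_minus, !RtoC_mult, RtoC_pow by lra.
      replace (RtoC (-1)) with (- (1)) by (apply injective_projections; simpl; ring).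
      assert (Hnz : 1 - RtoC alpha * RtoC x ^ 2 <> 0).
      { rewrite <- RtoC_pow, <- RtoC_mult, <- RtoC_minus. intros H. apply RtoC_inj in H. lra. }
      replace (1 - RtoC alpha * (- (1) * RtoC x * (- (1) * RtoC x))) with
        (1 - RtoC alpha * RtoC x ^ 2) by ring.
      field. assumption.
    (* Equality holds at x = rho; beyond it 2 x > 2 rho = 1 - alpha rho^2 >= 1 - alpha x^2. *)
    + assert (/ 2 <= x / (1 - alpha * x ^ 2))%R; [|lra].
      apply Rle_div_r; [lra|].
      assert (0 <= alpha * (x ^ 2 - rho ^ 2))%R by (apply Rmult_le_pos; nra). lra.
Qed.

(** The extremal function is z (1 - z)^(2 (beta - 1)). Its quotient 1 - 2 (beta - 1) z / (1 - z)
    maps the disc onto the half-plane Re < beta and descends to 1/2 at z = 1 / (4 beta - 3). *)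
Lemma M_radius_upper (beta : R) : (1 < beta)%R ->
  is_upper_bound (Scar_radius_set (M_class beta)) (1 / (4 * beta - 3)).
Proof.
  intros Hb.
  set (E := fun z => RtoC (2 * (beta - 1)) * Clog (1 - 1 * z)).
  assert (Hnz : forall z, inD z -> 1 - z <> 0).
  { intros z Hz H. pose proof (Re_1_minus_pos z Hz) as HRe. rewrite H in HRe. simpl in HRe. lra. }
  assert (HE : forall z, inD z -> Cis_derive E z (- RtoC (2 * (beta - 1)) / (1 - z))).
  { intros z Hz. destruct (Clog_1_minus_derive 1 z) as [_ D]; [now rewrite Cmult_1_l|].
    replace (- RtoC (2 * (beta - 1)) / (1 - z)) with
      (RtoC (2 * (beta - 1)) * (/ (1 - 1 * z) * - (1))).
    - now apply Cis_derive_scal.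
    - rewrite Cmult_1_l. field. now apply Hnz. }
  assert (HE0 : E 0 = 0).
  { unfold E. replace (1 - 1 * 0) with (RtoC 1) by ring. rewrite Clog_1. ring. }
  pose proof (extremal_classA _ _ HE HE0) as HA.
  pose proof (extremal_zfpf _ _ HE) as HZ.
  assert (Hrho : (0 < 1 / (4 * beta - 3))%R) by (apply Rdiv_lt_0_compat; lra).
  apply (radius_upper _ (fun z => z * cexp (E z))
    (fun x => 1 - 2 * (beta - 1) * x / (1 - x))%R 1); [|assumption| |assumption|].
  - split; [assumption|]. split; [intros z _; apply extremal_neq_0|].
    intros z Hz. rewrite HZ by assumption.
    pose proof (Hnz z Hz) as Hn.
    (* Written through 1 / (1 - z), whose real part exceeds 1/2 on the disc; the value 1/2 would
       give exactly 1 + (beta - 1) = beta. *)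
    replace (1 + z * (- RtoC (2 * (beta - 1)) / (1 - z))) with
      (1 - RtoC (2 * (beta - 1)) * (/ (1 - z) - 1)) by (field; assumption).
    assert (HI : (/ 2 < Re (/ (1 - z)))%R).
    { unfold inD in Hz. destruct z as [x y].
      assert (Hz2 : (x ^ 2 + y ^ 2 < 1)%R).
      { pose proof (Cmod2_alt (x, y)) as H2. simpl Re in H2. simpl Im in H2.
        pose proof (Cmod_ge_0 (x, y)). nra. }
      simpl.
      apply Rlt_div_r; nra. }
    set (u := / (1 - z)) in *.
    replace (Re (1 - RtoC (2 * (beta - 1)) * (u - 1)))
      with (1 - 2 * (beta - 1) * (Re u - 1))%R by (simpl; ring).
    nra.
  - apply Rabs_R1.
  - intros x Hx. assert (Hx3 : (1 < x * (4 * beta - 3))%R).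
    { apply Rlt_div_l; [lra|]. apply Hx. }
    rewrite Rmult_1_l. split.
    + rewrite HZ by (unfold inD; rewrite Cmod_R, Rabs_pos_eq; lra).
      assert (Hn : 1 - RtoC x <> 0).
      { apply Hnz. unfold inD. rewrite Cmod_R, Rabs_pos_eq; lra. }
      rewrite RtoC_minus, RtoC_div, (RtoC_mult (2 * (beta - 1)) x), (RtoC_minus 1 x) by lra.
      field. assumption.
    + assert (/ 2 <= 2 * (beta - 1) * x / (1 - x))%R; [|lra].
      apply Rle_div_r; lra.
Qed.

Theorem theorem4p4 :
  (forall alpha : R, (0 <= alpha < 1)%R ->
     Scar_radius_is (BL alpha) (1 / (1 + sqrt (1 + alpha)))%R) /\
  (forall beta : R, (1 < beta)%R ->
     Scar_radius_is (M_class beta) (1 / (4 * beta - 3))%R).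
Proof.
  split.
  - intros alpha Ha. set (rho := (1 / (1 + sqrt (1 + alpha)))%R).
    assert (Hs : (sqrt (1 + alpha) * sqrt (1 + alpha) = 1 + alpha)%R) by (apply sqrt_sqrt; lra).
    assert (Hs0 : (0 < sqrt (1 + alpha))%R) by (apply sqrt_lt_R0; lra).
    assert (Hrho : (0 < rho <= 1)%R).
    { split; [apply Rdiv_lt_0_compat; lra|]. apply Rle_div_l; lra. }
    assert (Heq : (alpha * rho ^ 2 + 2 * rho = 1)%R).
    (* With t = sqrt (1 + alpha), alpha = t^2 - 1 and rho = 1 / (1 + t), so the left side is (t - 1)
       / (1 + t) + 2 / (1 + t) = 1. *)
    { replace alpha with (sqrt (1 + alpha) * sqrt (1 + alpha) - 1)%R at 1 by lra.
      unfold rho. field. lra. }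
    split; [apply BL_radius_upper; lra|].
    (* The supremum is attained: rho itself belongs to the set, so every upper bound is at least
       rho. *)
    intros b Hb. apply Hb. apply BL_radius_member; lra.
  - intros beta Hb. split; [now apply M_radius_upper|].
    intros b Hub. apply Hub. now apply M_radius_member.
Qed.
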